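(* Up to projective equivalence (under $\mathrm{P\Gamma L}(9,2)$) there are exactly two $3$-dimensional pseudo-ovals in $\mathrm{PG}(8,2)$, and each of them is elementary: one arises from a conic $\mathcal C$ of $\mathrm{PG}(2,8)$ and the other from a pointed conic $\mathcal{PC}$ of $\mathrm{PG}(2,8)$.
   Context: A $3$-dimensional pseudo-oval in $\mathrm{PG}(8,2)$ is a set of $9$ projective planes of $\mathrm{PG}(8,2)$ any three of which span $\mathrm{PG}(8,2)$. Identifying $\mathrm{GF}(2)^9$ with $\mathrm{GF}(8)^3$ as $\mathrm{GF}(2)$-vector spaces, each point of $\mathrm{PG}(2,8)$ becomes a plane of $\mathrm{PG}(8,2)$, and an oval of $\mathrm{PG}(2,8)$ (9 points, no three collinear) becomes a $3$-dimensional pseudo-oval, called elementary and said to arise from that oval. A conic is a nondegenerate conic of $\mathrm{PG}(2,8)$, e.g. $\{(1,t,t^{1/2}):t\in\mathrm{GF}(8)\}\cup\{(0,1,0)\}$; a pointed conic is the oval obtained from a conic by deleting one point and adding the nucleus of the conic, e.g. $\{(1,t,t^2):t\in\mathrm{GF}(8)\}\cup\{(0,1,0)\}$. *)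

(* Defs.v *)
From HB Require Import structures.
From mathcomp Require Import all_boot all_order all_algebra all_fingroup all_field.
Set Implicit Arguments. Unset Strict Implicit. Unset Printing Implicit Defensive.
Import GRing.Theory.
Local Open Scope ring_scope.

(* GF(8) is an arbitrary finite field F of characteristic 2 and order 8   *)
(* (unique up to isomorphism).  [F8 cF] is F viewed as a GF(2)-algebra    *)
(* (a 3-dimensional 'F_2 vector space), and [V9 cF] = GF(8)^3 viewed as a *)
(* GF(2)-vector space of dimension 9: this is the identification of      *)
(* GF(2)^9 with GF(8)^3; PG(8,2) is the projective space of V9 cF.        *)
Definition F8 (F : finFieldType) (cF : 2 \in [pchar F]) := pPrimeCharType cF.
Definition V9 (F : finFieldType) (cF : 2 \in [pchar F]) := {ffun 'I_3 -> F8 cF}.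

Section PseudoOvals.
Variables (F : finFieldType) (cF : 2 \in [pchar F]).
Local Notation V := (V9 cF).

(* A (projective) plane of PG(8,2) = a 3-dimensional GF(2)-subspace.     *)
Definition pseudo_oval (s : seq {vspace V}) : Prop :=
  [/\ size s = 9%N, uniq s,
      (forall U, U \in s -> \dim U = 3%N) &
      (forall U1 U2 U3, U1 \in s -> U2 \in s -> U3 \in s ->
         U1 != U2 -> U1 != U3 -> U2 != U3 ->
         (U1 + U2 + U3)%VS = fullv)].

(* Projective equivalence under PGammaL(9,2) = GL(9,2) (GF(2) has no      *)
(* nontrivial automorphisms and no nontrivial scalars): some invertible   *)
(* GF(2)-linear map sends the first set of planes onto the second.        *)
Definition proj_equiv (s1 s2 : seq {vspace V}) : Prop :=
  exists f : 'End(V), (lker f == 0)%VS /\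
    perm_eq [seq (f @: U)%VS | U <- s1] s2.

(* A point of PG(2,8), given by a (nonzero) vector of GF(8)^3. *)
Definition vec3 (a b c : F8 cF) : V := [ffun j : 'I_3 => [:: a; b; c]`_j].

(* The plane of PG(8,2) corresponding to the point <p> of PG(2,8):        *)
(* the GF(8)-span { lambda p | lambda in GF(8) }, a GF(2)-subspace.       *)
Definition plane_of_point (p : V) : {vspace V} :=
  <<[seq [ffun j => (lam * p j)%R] | lam : F8 cF]>>%VS.

Definition elementary (pts : seq V) : seq {vspace V} :=
  [seq plane_of_point p | p <- pts].

(* Square root in GF(8): the unique s with s^2 = t (Frobenius is bijective). *)
Definition sqrt8 (t : F8 cF) : F8 cF := odflt 0 [pick s : F8 cF | s ^+ 2 == t].

Definition conic : seq V :=
  vec3 0 1 0 :: [seq vec3 1 t (sqrt8 t) | t : F8 cF].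

Definition pointed_conic : seq V :=
  vec3 0 1 0 :: [seq vec3 1 t (t ^+ 2) | t : F8 cF].

End PseudoOvals.

(* Main.v *)
Require Import Defs.
From HB Require Import structures.
From mathcomp Require Import all_boot all_order all_algebra all_fingroup all_field.
From mathcomp Require Import ring zify.
Set Implicit Arguments. Unset Strict Implicit. Unset Printing Implicit Defensive.

(* The two examples are pseudo-ovals by Vandermonde determinants. They are
   inequivalent: in both, the vectors lying in no sum of two planes are those
   of the plane of (0, 0, 1), so an equivalence preserves this plane N. The
   vectors covered by the planes form the graph of a function from V / N to N,
   which for the conic is, up to squaring, the GF(2)-quadratic x0 x1, whereas
   for the pointed conic it is x1^2 / x0, whose third differences over GF(2)
   do not vanish.

   Conversely, put four planes of a pseudo-oval in the position of the frame
   e1, e2, e3, e1 + e2 + e3 of PG(2,8). The others become graphs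
   {(x, a x, b x)} of pairs of GF(2)-linear maps of GF(8). Any two of the maps
   0, 1 and a, a', ... differ at every x <> 0, i.e. they form a partial spread
   set; after conjugation one of the a's is a multiplication, and then a small
   enumeration shows that all are.
   Running over the b's for the remaining planes {(x, v x, b x)}, one per v,
   leaves 60 configurations; in each every b is a multiplication, and an
   explicit element of GL(3,8) takes the conic or the pointed conic to the
   resulting oval. *)

(** * Enumerations over a concrete GF(8) *)

(* A concrete GF(8) = GF(2)[w] with w^3 = w + 1; (x0, x1, x2) stands for
   x0 + x1 w + x2 w^2. *)
Definition gf8 := (bool * bool * bool)%type.

Definition zero8 : gf8 := (false, false, false).
Definition one8 : gf8 := (true, false, false).
Definition gen8 : gf8 := (false, true, false).

Definition add8 (x y : gf8) : gf8 :=
  let: (x0, x1, x2) := x in let: (y0, y1, y2) := y in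
  (x0 (+) y0, x1 (+) y1, x2 (+) y2).

Definition mulgen8 (x : gf8) : gf8 :=
  let: (x0, x1, x2) := x in (x2, x0 (+) x2, x1).

(* (a0, a1, a2) stands for the GF(2)-linear map of GF(8) sending 1, w, w^2
   to a0, a1, a2. *)
Definition map8 := (gf8 * gf8 * gf8)%type.

Definition app8 (a : map8) (x : gf8) : gf8 :=
  let: (a0, a1, a2) := a in let: (x0, x1, x2) := x in
  add8 (if x0 then a0 else zero8)
    (add8 (if x1 then a1 else zero8) (if x2 then a2 else zero8)).

Definition mulmap8 (c : gf8) : map8 := (c, mulgen8 c, mulgen8 (mulgen8 c)).

Definition mul8 (x y : gf8) : gf8 := app8 (mulmap8 x) y.

(** The power x^6, which inverts x because nonzero elements satisfy x^7 = 1. *)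
Definition inv8 (x : gf8) : gf8 :=
  let x2 := mul8 x x in mul8 x2 (mul8 x2 x2).

Definition gf8_enum : seq gf8 :=
  [seq (p, z) | p <- [seq (x, y) | x <- [:: false; true], y <- [:: false; true]],
                z <- [:: false; true]].

Definition gf8_units : seq gf8 := behead gf8_enum.

Definition map8_enum : seq map8 :=
  [seq (p, z) | p <- [seq (x, y) | x <- gf8_enum, y <- gf8_enum], z <- gf8_enum].

(** Equivalently, a - b is invertible: this is the condition on the members of a partial spread
    set. *)
Definition apart (a b : map8) : bool :=
  all (fun x => app8 a x != app8 b x) gf8_units.

(** The elements of GL(3,2) that fix no nonzero vector. *)
Definition fpf_enum : seq map8 :=
  [seq a <- map8_enum | apart a (mulmap8 zero8) && apart a (mulmap8 one8)].

Definition is_mul8 (a : map8) : bool := a == mulmap8 (app8 a one8).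

Definition conj_mul8 (a : map8) (c : gf8) (g : map8) : bool :=
  apart g (mulmap8 zero8) &&
    all (fun x => app8 g (app8 a x) == mul8 c (app8 g x)) gf8_enum.

(** The characteristic polynomial of such a map is a cubic over GF(2) without the roots 0 and 1,
    hence irreducible: X^3 + X + 1 or X^3 + X^2 + 1, the minimal polynomials of [gen8] and of its
    inverse. An irreducible characteristic polynomial determines the conjugacy class. *)
Lemma fpf_conj_mul8 :
  all (fun a => has (fun c => has (conj_mul8 a c) map8_enum) [:: gen8; inv8 gen8])
    fpf_enum.
Proof. by lazy. Qed.

(** Applied to partial spread sets containing 0, 1, c and two further maps; a pseudo-oval has enough
    planes to supply the second one. *)
Lemma spread_is_mul8 :
  all (fun c => let L := [seq a <- fpf_enum | apart a (mulmap8 c)] in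
         all (fun a => has (apart a) L ==> is_mul8 a) L)
    [:: gen8; inv8 gen8].
Proof. by lazy. Qed.

(* For p = (v, b) etc., independence of the three planes {(x, v x, b x)}: a
   dependency x + y + z = 0 = v x + v' y + v'' z forces y = k x. *)
Definition indep8 (p q r : gf8 * map8) : bool :=
  let k := mul8 (add8 p.1 r.1) (inv8 (add8 q.1 r.1)) in
  all (fun x => let y := mul8 k x in
         add8 (app8 p.2 x) (add8 (app8 q.2 y) (app8 r.2 (add8 x y))) != zero8)
      gf8_units.

(** [acc] is compatible by construction, so only the pairs and triples that involve [p] are
    tested. *)
Fixpoint compat (p : gf8 * map8) (acc : seq (gf8 * map8)) : bool :=
  if acc is q :: acc' then
    [&& apart p.2 q.2, all (indep8 p q) acc' & compat p acc']
  else true.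

(** Depth-first: the slopes come in the order of [vs], and a branch is cut at the first violated
    pair or triple. *)
Fixpoint search (leaf : seq (gf8 * map8) -> bool) (vs : seq gf8) acc : bool :=
  if vs is v :: vs' then
    all (fun b => compat (v, b) acc ==> search leaf vs' ((v, b) :: acc)) fpf_enum
  else leaf acc.

Definition vec8 := (gf8 * gf8 * gf8)%type.

Definition addv8 (p q : vec8) : vec8 :=
  let: (p0, p1, p2) := p in let: (q0, q1, q2) := q in
  (add8 p0 q0, add8 p1 q1, add8 p2 q2).

Definition scale8 (k : gf8) (p : vec8) : vec8 :=
  let: (p0, p1, p2) := p in (mul8 k p0, mul8 k p1, mul8 k p2).

Definition lin8 (h : vec8 * vec8 * vec8) (p : vec8) : vec8 :=
  let: (h0, h1, h2) := h in let: (p0, p1, p2) := p in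
  addv8 (scale8 p0 h0) (addv8 (scale8 p1 h1) (scale8 p2 h2)).

Definition unit8 (i : nat) : vec8 :=
  let d j := if i == j then one8 else zero8 in (d 0, d 1, d 2).

Definition coord8 (i : nat) (p : vec8) : gf8 := nth zero8 [:: p.1.1; p.1.2; p.2] i.

(** Parametrised by the square root, so that no root has to be computed. *)
Definition conic8 : seq vec8 :=
  unit8 1 :: [seq (one8, mul8 t t, t) | t <- gf8_enum].

Definition pointed_conic8 : seq vec8 :=
  unit8 1 :: [seq (one8, t, mul8 t t) | t <- gf8_enum].

(** Points are compared up to a scalar. The invertibility of [h] will follow in [cover_equiv],
    because the covered planes span. *)
Definition covers (h : vec8 * vec8 * vec8) (target pts : seq vec8) : bool :=
  let im := [seq lin8 h q | q <- target] in
  all (fun p => has (fun q => has (fun k => scale8 k p == q) gf8_units) im) pts.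

Definition point8 (p : gf8 * map8) : vec8 := (one8, p.1, app8 p.2 one8).

(* Adding the sum of the affine points turns the oval into a hyperoval, since
   the elements of GF(8) sum to zero. *)
Definition tenth_point (acc : seq (gf8 * map8)) : vec8 :=
  foldr addv8 (zero8, zero8, zero8) [seq point8 p | p <- acc].

(* The columns are multiples of unit8 i, nu and delta whose sum is a multiple
   of the unit vector other than unit8 i and unit8 k. Thus (1, 0, 0), (0, 1, 0)
   and (1, 1, 1), which lie on both ovals, go to points of the given oval, and
   (0, 0, 1), the tenth point of both hyperovals, goes to delta. *)
Definition frame8 (i k : nat) (nu delta : vec8) : vec8 * vec8 * vec8 :=
  let d := add8 (mul8 (coord8 i nu) (coord8 k delta))
                (mul8 (coord8 i delta) (coord8 k nu)) in
  (scale8 d (unit8 i), scale8 (coord8 k delta) nu, scale8 (coord8 k nu) delta).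

(** In a pointed conic, (0, 1, 0) is the nucleus of the underlying conic, so its image [nu] has to
    be searched for. The points (1, 0, 0) and (1, 1, 1) go to two of the three unit points; the
    three index pairs run through the three choices of two, one of which avoids [nu]. *)
Definition classified (acc : seq (gf8 * map8)) : bool :=
  let pts := [:: unit8 1, unit8 2 & [seq point8 p | p <- acc]] in
  let delta := tenth_point acc in
  all (fun p => is_mul8 p.2) acc &&
  has (fun ik => has (fun nu =>
       let h := frame8 ik.1 ik.2 nu delta in
       covers h conic8 pts || covers h pointed_conic8 pts) pts)
    [:: (0, 2); (0, 1); (1, 0)].

(** Here [m] is the missing slope: the seven planes besides those of (0, 1, 0) and (0, 0, 1) have
    distinct slopes in GF(8), two of which are 0 and 1. *)
Lemma search_classified :
  all (fun m => search classified [seq v <- gf8_units | (v != one8) && (v != m)]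
         [:: (one8, mulmap8 one8); (zero8, mulmap8 zero8)])
    [seq v <- gf8_units | v != one8].
Proof. by lazy. Qed.

(** * Soundness of the enumerations and of the search *)

Lemma mem_gf8_enum x : x \in gf8_enum.
Proof. by move: x => [[[] []] []]. Qed.

Lemma mem_gf8_units x : (x \in gf8_units) = (x != zero8).
Proof. by move: x => [[[] []] []]. Qed.

Lemma mem_map8_enum a : a \in map8_enum.
Proof.
case: a => [[x y] z]; apply/allpairsP; exists ((x, y), z).
split; rewrite ?mem_gf8_enum //; apply/allpairsP; exists (x, y).
by rewrite !mem_gf8_enum.
Qed.

Lemma mem_fpf_enum a :
  (a \in fpf_enum) = apart a (mulmap8 zero8) && apart a (mulmap8 one8).
Proof. by rewrite mem_filter mem_map8_enum andbT. Qed.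

Lemma compat_map (B : gf8 -> map8) v us :
  {in us, forall u, apart (B v) (B u)} ->
  {in us &, forall u t, u != t -> indep8 (v, B v) (u, B u) (t, B t)} ->
  uniq us -> compat (v, B v) [seq (u, B u) | u <- us].
Proof.
elim: us => //= u us IH ap ind /andP[nu un]; rewrite ap ?mem_head //=.
apply/andP; split; last first.
  apply: IH => // [t ht|t r ht hr]; first by apply: ap; rewrite inE ht orbT.
  by apply: ind; rewrite inE ?ht ?hr orbT.
apply/allP=> _ /mapP[t ht ->]; apply: ind; rewrite ?mem_head //.
  by rewrite inE ht orbT.
by apply: contraNneq nu => ->.
Qed.

(** An actual configuration [B] passes every pruning test, so its branch reaches a leaf.
    [catrev vs us] is the order in which the search stacks the slopes. *)
Lemma search_map leaf (B : gf8 -> map8) vs us :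
  search leaf vs [seq (u, B u) | u <- us] -> uniq (catrev vs us) ->
  {in vs, forall v, B v \in fpf_enum} ->
  {in catrev vs us &, forall v u, v != u -> apart (B v) (B u)} ->
  {in catrev vs us & &, forall v u t, v != u -> v != t -> u != t ->
     indep8 (v, B v) (u, B u) (t, B t)} ->
  leaf [seq (u, B u) | u <- catrev vs us].
Proof.
elim: vs us => // v vs IH us srch un fpf ap ind.
have {}srch : {in fpf_enum, forall b, compat (v, b) [seq (u, B u) | u <- us] ->
    search leaf vs ((v, b) :: [seq (u, B u) | u <- us])}.
  by move=> b hb; apply/implyP; apply: (allP srch).
have sub : {subset v :: us <= catrev vs (v :: us)}.
  by move=> x hx; rewrite catrevE mem_cat hx orbT.
have /andP[nv un'] : uniq (v :: us).
  by move: un; rewrite [catrev _ _]/= catrevE cat_uniq => /and3P[].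
have ne u : u \in us -> v != u by move=> hu; apply: contraNneq nv => ->.
apply: (IH (v :: us)) => //.
- apply: srch; first by rewrite fpf ?mem_head.
  apply: compat_map => //.
    by move=> u hu; apply: ap (ne u hu); apply: sub; rewrite !inE ?eqxx ?hu ?orbT.
  move=> u t hu ht; apply: ind; rewrite ?ne //; apply: sub;
    by rewrite !inE ?eqxx ?hu ?ht ?orbT.
- by move=> u hu; apply: fpf; rewrite inE hu orbT.
Qed.

Lemma classifiedP acc : classified acc ->
  all (fun p => is_mul8 p.2) acc /\
  exists h, exists2 target, target = conic8 \/ target = pointed_conic8 &
    forall p, p \in [:: unit8 1, unit8 2 & [seq point8 p | p <- acc]] ->
      exists q k, [/\ q \in target, k != zero8 & scale8 k p = lin8 h q].
Proof.
case/andP=> mulP /hasP[ik _ /hasP[nu _ cov]]; split=> //.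
exists (frame8 ik.1 ik.2 nu (tenth_point acc)).
case/orP: cov => /allP cov; [exists conic8 | exists pointed_conic8]; auto.
- by move=> p /cov /hasP[_ /mapP[q hq ->] /hasP[k]]; rewrite mem_gf8_units => k0 /eqP E;
    exists q, k.
- by move=> p /cov /hasP[_ /mapP[q hq ->] /hasP[k]]; rewrite mem_gf8_units => k0 /eqP E;
    exists q, k.
Qed.

Import GRing.Theory.
Local Open Scope ring_scope.

(** * The conic and the pointed conic *)

Lemma exists_notin (T : eqType) (s l : seq T) : uniq s -> (size l < size s)%N ->
  exists2 x, x \in s & x \notin l.
Proof.
move=> un sz; apply/hasP; rewrite -[has _ _]negbK -all_predC; apply/negP=> /allP h.
have /(uniq_leq_size un) : {subset s <= l} by move=> x /h /=; rewrite negbK.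
by rewrite leqNgt sz.
Qed.

Lemma additive_lfun (aT rT : vectType 'F_2) (g : aT -> rT) :
  {morph g : x y / x + y} -> exists f : 'Hom(aT, rT), f =1 g.
Proof.
move=> gD.
have g0 : g 0 = 0 by apply: (addrI (g 0)); rewrite -gD !addr0.
have glin : linear g.
  move=> k x y; rewrite gD; congr (_ + _).
  have [->|->] : k = 0 \/ k = 1.
    by case: k => -[|[|n]] // lt; [left | right]; apply: val_inj.
  - by rewrite !scale0r.
  - by rewrite !scale1r.
pose gl := GRing.isLinear.Build _ _ _ _ g glin.
pose G : {linear aT -> rT} := HB.pack g gl.
by exists (linfun G) => x; rewrite lfunE.
Qed.

Section Planes.
Variables (F : finFieldType) (cF : 2 \in [pchar F]) (hF : #|F| = 8%N).
Local Notation L := (F8 cF).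
Local Notation V := (V9 cF).
Implicit Types (x y t : L) (u v p q r : V) (U W : {vspace V}).

Lemma pcharL : 2 \in [pchar L]. Proof. exact: cF. Qed.

Lemma two0 : 2%:R = 0 :> L. Proof. exact: pcharf0 pcharL. Qed.

Lemma addLL x : x + x = 0. Proof. exact: addrr_pchar2 pcharL x. Qed.

Lemma oppL x : - x = x. Proof. exact: oppr_pchar2 pcharL x. Qed.

Lemma addL_eq0 x y : (x + y == 0) = (x == y).
Proof. by rewrite -{1}(oppL y) subr_eq0. Qed.

Lemma addVV v : v + v = 0.
Proof. by apply/ffunP=> j; rewrite !ffunE addLL. Qed.

Lemma oppV v : - v = v.
Proof. by apply/eqP; rewrite eq_sym -subr_eq0 opprK addVV. Qed.

Lemma expL8 x : x ^+ 8 = x.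
Proof. by rewrite -{2}(expf_card x) hF. Qed.

Lemma dimL : \dim {: L} = 3%N.
Proof.
have E : #|{: L}%VS| = (2 ^ \dim {: L})%N by rewrite card_vspace card_Fp.
apply/eqP; rewrite -(eqn_exp2l _ 3 (isT : (1 < 2)%N)) -E.
by rewrite (eq_card (B := L)) ?[#|_|]hF // => x; rewrite memvf.
Qed.

Lemma dimV : \dim {: V} = 9%N.
Proof.
have E : #|{: V}%VS| = (2 ^ \dim {: V})%N by rewrite card_vspace card_Fp.
apply/eqP; rewrite -(eqn_exp2l _ 9 (isT : (1 < 2)%N)) -E.
rewrite (eq_card (B := V)) => [|v]; last by rewrite memvf.
by rewrite card_ffun card_ord [#|_|]hF.
Qed.

Definition j0 : 'I_3 := @Ordinal 3 0 isT.
Definition j1 : 'I_3 := @Ordinal 3 1 isT.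
Definition j2 : 'I_3 := @Ordinal 3 2 isT.

Lemma vec3E x y t : (vec3 x y t j0 = x) * (vec3 x y t j1 = y) * (vec3 x y t j2 = t).
Proof. by rewrite /vec3 !ffunE. Qed.

Lemma eqVP u v : u j0 = v j0 -> u j1 = v j1 -> u j2 = v j2 -> u = v.
Proof.
move=> e0 e1 e2; apply/ffunP=> j.
by case: j => -[|[|[|]]] // lt; [move: e0|move: e1|move: e2];
   congr (u _ = v _); apply: val_inj.
Qed.

Lemma vec3K v : vec3 (v j0) (v j1) (v j2) = v.
Proof. by apply: eqVP; rewrite !vec3E. Qed.

Lemma vec3D x y t x' y' t' :
  vec3 x y t + vec3 x' y' t' = vec3 (x + x') (y + y') (t + t').
Proof. by apply: eqVP; rewrite ffunE !vec3E. Qed.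

Lemma vec3_inj x y t x' y' t' :
  vec3 x y t = vec3 x' y' t' -> [/\ x = x', y = y' & t = t'].
Proof.
by move=> E; split; [move: (congr1 (fun v : V => v j0) E)
  | move: (congr1 (fun v : V => v j1) E) | move: (congr1 (fun v : V => v j2) E)];
  rewrite !vec3E.
Qed.

Lemma vec3_0 : vec3 0 0 0 = 0 :> V.
Proof. by apply: eqVP; rewrite vec3E ffunE. Qed.

Definition smul x v : V := [ffun j => x * v j].

Lemma smulE x v j : smul x v j = x * v j. Proof. by rewrite ffunE. Qed.

Lemma smul_vec3 k x y t : smul k (vec3 x y t) = vec3 (k * x) (k * y) (k * t).
Proof. by apply: eqVP; rewrite smulE !vec3E. Qed.

Lemma smulDl x y v : smul (x + y) v = smul x v + smul y v.
Proof. by apply/ffunP=> j; rewrite !ffunE mulrDl. Qed.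

Lemma smulDr x u v : smul x (u + v) = smul x u + smul x v.
Proof. by apply/ffunP=> j; rewrite !ffunE mulrDr. Qed.

Lemma smulA x y v : smul x (smul y v) = smul (x * y) v.
Proof. by apply/ffunP=> j; rewrite !ffunE mulrA. Qed.

Lemma smul1 v : smul 1 v = v.
Proof. by apply/ffunP=> j; rewrite !ffunE mul1r. Qed.

Lemma smul0 v : smul 0 v = 0.
Proof. by apply/ffunP=> j; rewrite !ffunE mul0r. Qed.

(** The multiples of [p] are already closed under addition, so taking the span adds nothing. *)
Lemma plane_of_pointE p :
  exists2 f : 'Hom(L, V), f =1 smul^~ p & plane_of_point p = limg f.
Proof.
have [f fE] : exists f : 'Hom(L, V), f =1 smul^~ p.
  by apply: additive_lfun => x y; exact: smulDl.
exists f => //; apply/eqP; rewrite eqEsubv; apply/andP; split.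
  apply/span_subvP=> _ /mapP[x _ ->].
  by rewrite -[finfun _]/(smul x p) -fE memv_img ?memvf.
apply/subvP=> _ /memv_imgP[x _ ->]; rewrite fE.
by apply: memv_span; apply/mapP; exists x; rewrite ?mem_enum.
Qed.

Lemma mem_planeP p v :
  reflect (exists x, v = smul x p) (v \in plane_of_point p).
Proof.
apply: (iffP idP) => [|[x ->]]; have [f fE ->] := plane_of_pointE p.
  by case/memv_imgP=> x _ ->; exists x; rewrite fE.
by rewrite -fE memv_img ?memvf.
Qed.

Lemma smul_eq0 x p : p != 0 -> smul x p = 0 -> x = 0.
Proof.
move=> p0 E; apply/eqP; apply: contraNT p0 => x0.
apply/eqP/ffunP=> j; apply: (mulfI x0).
by rewrite -smulE E !ffunE mulr0.
Qed.

Lemma dim_plane p : p != 0 -> \dim (plane_of_point p) = 3%N.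
Proof.
move=> p0; have [f fE ->] := plane_of_pointE p.
rewrite limg_dim_eq ?dimL // capfv; apply/eqP.
by apply/lker0P=> x y; rewrite !fE => E; apply/eqP; rewrite -subr_eq0;
   apply/eqP/(smul_eq0 p0); rewrite smulDl E -smulDl subrr smul0.
Qed.

(** * Spanning triples of planes, and arcs as pseudo-ovals *)

Definition indep3s U1 U2 U3 := forall u1 u2 u3,
  u1 \in U1 -> u2 \in U2 -> u3 \in U3 -> u1 + u2 + u3 = 0 ->
  [/\ u1 = 0, u2 = 0 & u3 = 0].

(** Dimension count: as 3 + 3 + 3 = 9, the sum is everything exactly when it is direct. *)
Lemma full3P U1 U2 U3 : \dim U1 = 3%N -> \dim U2 = 3%N -> \dim U3 = 3%N ->
  (U1 + U2 + U3)%VS = fullv <-> indep3s U1 U2 U3.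
Proof.
move=> d1 d2 d3; split=> [full u1 u2 u3 h1 h2 h3 E|ind].
  have := dimv_sum_cap U1 U2; rewrite d1 d2.
  have := dimv_sum_cap (U1 + U2) U3; rewrite full dimV d3.
  move=> e1 e2.
  have c12 : \dim (U1 :&: U2) = 0%N.
    by move: e1 e2; case: (\dim (U1 :&: U2)) => // n; rewrite !addnS; lia.
  have c3 : \dim ((U1 + U2) :&: U3) = 0%N by lia.
  have u30 : u3 = 0.
    apply/eqP; rewrite -memv0; have /eqP <- : ((U1 + U2) :&: U3 == 0)%VS.
      by rewrite -dimv_eq0 c3.
    rewrite memv_cap h3 andbT -[u3]oppV -(addr0_eq E) opprK.
    by rewrite memv_add.
  have u10 : u1 = 0.
    apply/eqP; rewrite -memv0; have /eqP <- : (U1 :&: U2 == 0)%VS.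
      by rewrite -dimv_eq0 c12.
    move: E; rewrite u30 addr0 => /addr0_eq E.
    by rewrite memv_cap h1 -[u1]oppV E.
  by move: E; rewrite u10 u30 add0r addr0 => ->.
have c12 : \dim (U1 :&: U2) = 0%N.
  apply/eqP; rewrite dimv_eq0 -subv0; apply/subvP=> v.
  rewrite memv_cap memv0 => /andP[v1 v2].
  by have [-> _ _] := ind v v 0 v1 v2 (mem0v _) (etrans (addr0 _) (addVV v)).
have c3 : \dim ((U1 + U2) :&: U3) = 0%N.
  apply/eqP; rewrite dimv_eq0 -subv0; apply/subvP=> v.
  rewrite memv_cap memv0 => /andP[/memv_addP[a a1 [b b2 vE]] v3].
  by have [_ _ ->] := ind a b v a1 b2 v3 (etrans (congr1 (+%R^~ v) (esym vE)) (addVV v)).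
apply/eqP; rewrite eqEdim subvf dimV /=.
have := dimv_sum_cap U1 U2; rewrite d1 d2 c12.
have := dimv_sum_cap (U1 + U2) U3; rewrite d3 c3; lia.
Qed.

Lemma vandermonde3 (a b c s1 s2 s3 : L) : s1 != s3 -> s2 != s3 ->
  a + b + c = 0 -> a * s1 + b * s2 + c * s3 = 0 ->
  a * s1 ^+ 2 + b * s2 ^+ 2 + c * s3 ^+ 2 = 0 -> c = 0.
Proof.
move=> n1 n2 e0 e1 e2; apply/eqP.
have: c * ((s1 - s3) * (s2 - s3)) = 0.
  (* The coefficients of (X - s1)(X - s2) eliminate a and b. *)
  rewrite -[RHS](_ : (a * s1 ^+ 2 + b * s2 ^+ 2 + c * s3 ^+ 2)
    - (s1 + s2) * (a * s1 + b * s2 + c * s3) + s1 * s2 * (a + b + c) = 0).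
    by ring.
  by rewrite e0 e1 e2 !mulr0 subr0 addr0.
by move/eqP; rewrite !mulf_eq0 !subr_eq0 (negbTE n1) (negbTE n2) !orbF.
Qed.

(** The independence condition speaks only of the last coefficient; permuting the three points gives
    the other two. *)
Lemma arc_pseudo_oval (pts : seq V) :
  size pts = 9%N -> uniq pts ->
  (forall p q r, p \in pts -> q \in pts -> r \in pts ->
     p != q -> p != r -> q != r -> forall x y t,
     smul x p + smul y q + smul t r = 0 -> t = 0) ->
  pseudo_oval (elementary pts).
Proof.
move=> sz un ind.
have ind3 p q r x y t : p \in pts -> q \in pts -> r \in pts ->
  p != q -> p != r -> q != r ->
  smul x p + smul y q + smul t r = 0 -> [/\ x = 0, y = 0 & t = 0].
  move=> hp hq hr pq pr qr E; split.
  - apply: (ind q r p hq hr hp qr _ _ y t); rewrite 1?eq_sym //.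
    by rewrite -E addrC addrA.
  - apply: (ind r p q hr hp hq _ _ pq t x); rewrite 1?eq_sym //.
    by rewrite -E -addrA addrC.
  - exact: (ind p q r hp hq hr pq pr qr x y).
have third p q : exists2 r, r \in pts & (p != r) && (q != r).
  have [|r hr] := @exists_notin _ pts [:: p; q] un; first by rewrite sz.
  by rewrite !inE negb_or ![r == _]eq_sym => h; exists r.
have nz p : p \in pts -> p != 0.
  move=> hp; have [q hq /andP[pq _]] := third p p.
  have [r hr /andP[pr qr]] := third p q.
  apply/eqP=> p0; have [] := ind3 p q r 1 0 0 hp hq hr pq pr qr.
    by rewrite p0 !smul0 smul1 !addr0.
  by move/eqP; rewrite oner_eq0.
have indU p q r : p \in pts -> q \in pts -> r \in pts ->
  p != q -> p != r -> q != r ->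
  indep3s (plane_of_point p) (plane_of_point q) (plane_of_point r).
  move=> hp hq hr pq pr qr _ _ _ /mem_planeP[x ->] /mem_planeP[y ->] /mem_planeP[t ->] E.
  by have [-> -> ->] := ind3 p q r x y t hp hq hr pq pr qr E; rewrite !smul0.
have inj : {in pts &, injective (@plane_of_point F cF)}.
  move=> p q hp hq E; apply/eqP; apply/negP=> /negP pq.
  have [r hr /andP[pr qr]] := third p q.
  have pin : p \in plane_of_point q
    by rewrite -E; apply/mem_planeP; exists 1; rewrite smul1.
  have pin' : p \in plane_of_point p by apply/mem_planeP; exists 1; rewrite smul1.
  have [] := indU p q r hp hq hr pq pr qr p p 0 pin' pin (mem0v _).
    by rewrite addr0 addVV.
  by move/eqP; rewrite (negbTE (nz p hp)).
split.
- by rewrite size_map.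
- by rewrite map_inj_in_uniq.
- by move=> _ /mapP[p hp ->]; rewrite dim_plane ?nz.
move=> _ _ _ /mapP[p hp ->] /mapP[q hq ->] /mapP[r hr ->] pq pr qr.
apply/full3P; rewrite ?dim_plane ?nz //.
by apply: indU => //; [move: pq|move: pr|move: qr]; apply: contraNneq => ->.
Qed.

(** Since t^8 = t, a root s of t satisfies s = s^8 = t^4. *)
Lemma sqrt8E t : sqrt8 t = t ^+ 4.
Proof.
rewrite /sqrt8; case: pickP => [s /eqP sE|/(_ (t ^+ 4))] /=.
  by rewrite -[LHS]expL8 -sE -exprM.
by rewrite -exprM expL8 eqxx.
Qed.

Lemma sqrt8_sqr t : sqrt8 (t ^+ 2) = t.
Proof. by rewrite sqrt8E -exprM expL8. Qed.

Lemma sqr_sqrt8 t : sqrt8 t ^+ 2 = t.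
Proof. by rewrite sqrt8E -exprM expL8. Qed.

Lemma sqrL_inj : injective (fun t => t ^+ 2).
Proof. by move=> x y E; rewrite -[x]sqrt8_sqr -[y]sqrt8_sqr E. Qed.

(** The substitution of t^2 for t puts the points in the form used by [conic8]. *)
Lemma mem_conic p : reflect (p = vec3 0 1 0 \/ exists t, p = vec3 1 (t ^+ 2) t)
  (p \in conic cF).
Proof.
rewrite inE; apply: (iffP orP) => -[/eqP h|h].
- by left.
- by case/mapP: h => t _ ->; right; exists (sqrt8 t); rewrite sqr_sqrt8.
- by left; rewrite h.
- case: h => t ->; right; apply/mapP; exists (t ^+ 2); rewrite ?mem_enum //.
  by rewrite sqrt8_sqr.
Qed.

Lemma mem_pointed_conic p :
  reflect (p = vec3 0 1 0 \/ exists t, p = vec3 1 t (t ^+ 2))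
  (p \in pointed_conic cF).
Proof.
rewrite inE; apply: (iffP orP) => -[/eqP h|h].
- by left.
- by case/mapP: h => t _ ->; right; exists t.
- by left; rewrite h.
- by case: h => t ->; right; apply/mapP; exists t; rewrite ?mem_enum.
Qed.

Lemma vandermonde2 (a b s1 s2 : L) : s1 != s2 ->
  a + b = 0 -> a * s1 + b * s2 = 0 -> b = 0.
Proof.
move=> n e0 e1; apply/eqP.
have : b * (s2 - s1) = 0.
  rewrite -[RHS](_ : (a * s1 + b * s2) - (a + b) * s1 = 0); first by ring.
  by rewrite e0 e1 mul0r subr0.
by move/eqP; rewrite mulf_eq0 subr_eq0 [s2 == _]eq_sym (negbTE n) orbF.
Qed.

(** The point (0, 1, 0) affects only the middle coordinate; if it occurs, the outer coordinates 1, s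
    of the other two points still give a 2 x 2 Vandermonde determinant. *)
Lemma conic_pseudo_oval : pseudo_oval (elementary (conic cF)).
Proof.
apply: arc_pseudo_oval.
- by rewrite /= size_map -cardE [#|_|]hF.
- rewrite /= map_inj_uniq ?enum_uniq ?andbT; last by move=> x y /vec3_inj[].
  by apply/mapP=> -[t _ /vec3_inj[/eqP]]; rewrite eq_sym oner_eq0.
move=> p q r /mem_conic[->|[s1 ->]] /mem_conic[->|[s2 ->]] /mem_conic[->|[s3 ->]];
  rewrite ?eqxx // => n12 n13 n23 x y t; rewrite !smul_vec3 !vec3D -vec3_0;
  case/vec3_inj; rewrite ?mulr1 ?mulr0 ?addr0 ?add0r => e0 e1 e2.
- apply: (@vandermonde2 y t s2 s3) => //.
  by apply: contraNneq n23 => ->.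
- apply: (@vandermonde2 x t s1 s3) => //.
  by apply: contraNneq n13 => ->.
- have y0 : y = 0.
    apply: (@vandermonde2 x y s1 s2) => //.
    by apply: contraNneq n12 => ->.
  by move: e0 e1; rewrite y0 addr0 => ->; rewrite !mul0r !add0r.
- apply: (@vandermonde3 x y t s1 s2 s3) => //.
    by apply: contraNneq n13 => ->.
  by apply: contraNneq n23 => ->.
Qed.

(** As for the conic, except that the outer coordinates are now 1, s^2, which differ for different s
    because squaring is injective. *)
Lemma pointed_conic_pseudo_oval : pseudo_oval (elementary (pointed_conic cF)).
Proof.
apply: arc_pseudo_oval.
- by rewrite /= size_map -cardE [#|_|]hF.
- rewrite /= map_inj_uniq ?enum_uniq ?andbT; last by move=> x y /vec3_inj[].
  by apply/mapP=> -[t _ /vec3_inj[/eqP]]; rewrite eq_sym oner_eq0.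
move=> p q r /mem_pointed_conic[->|[s1 ->]] /mem_pointed_conic[->|[s2 ->]]
  /mem_pointed_conic[->|[s3 ->]];
  rewrite ?eqxx // => n12 n13 n23 x y t; rewrite !smul_vec3 !vec3D -vec3_0;
  case/vec3_inj; rewrite ?mulr1 ?mulr0 ?addr0 ?add0r => e0 e1 e2.
- apply: (@vandermonde2 y t (s2 ^+ 2) (s3 ^+ 2)) => //.
  by apply: contraNneq n23 => /sqrL_inj->.
- apply: (@vandermonde2 x t (s1 ^+ 2) (s3 ^+ 2)) => //.
  by apply: contraNneq n13 => /sqrL_inj->.
- have y0 : y = 0.
    apply: (@vandermonde2 x y (s1 ^+ 2) (s2 ^+ 2)) => //.
    by apply: contraNneq n12 => /sqrL_inj->.
  by move: e0 e1; rewrite y0 addr0 => ->; rewrite !mul0r !add0r.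
- apply: (@vandermonde3 x y t s1 s2 s3) => //.
    by apply: contraNneq n13 => ->.
  by apply: contraNneq n23 => ->.
Qed.

(** * Inequivalence of the two examples *)

Lemma sqrD x y : (x + y) ^+ 2 = x ^+ 2 + y ^+ 2.
Proof. by rewrite -[RHS]addr0 -(mul0r (x * y)) -two0; ring. Qed.

Lemma exists_gen : exists w : L, w ^+ 3 = w + 1.
Proof.
have [x x0 x1] : exists2 x : L, x != 0 & x != 1.
  have [x hx] : exists x : L, x \notin [:: 0; 1].
    apply/existsP; apply: contraTT (isT : (2 < 8)%N) => /existsPn h.
    rewrite -leqNgt -hF; apply: leq_trans (card_size [:: 0; 1 : L]).
    by apply: subset_leq_card; apply/subsetP=> x _; have := h x; rewrite negbK.
  by exists x; move: hx; rewrite !inE negb_or => /andP[].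
(* Over GF(2) this product is X^8 + X; over the integers the two differ by an even polynomial. *)
have : x * (x + 1) * (x ^+ 3 + x + 1) * (x ^+ 3 + x ^+ 2 + 1) = 0.
  have -> : x * (x + 1) * (x ^+ 3 + x + 1) * (x ^+ 3 + x ^+ 2 + 1) = x ^+ 8 + x +
    2%:R * (x ^+ 7 + x ^+ 6 + 2%:R * x ^+ 5 + 2%:R * x ^+ 4 + x ^+ 3 + x ^+ 2).
    by ring.
  by rewrite two0 mul0r addr0 expL8 addLL.
move/eqP; rewrite !mulf_eq0 (negbTE x0) addL_eq0 (negbTE x1) /=.
case/orP=> /eqP E.
  exists x; apply/eqP; rewrite -addL_eq0 addrA; exact/eqP.
(* Translation by 1 exchanges the two irreducible cubics. *)
exists (x + 1); apply/eqP; rewrite -addL_eq0; apply/eqP.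
rewrite -[RHS]E -[RHS]addr0 -(mul0r (x ^+ 2 + 2%:R * x + 1)) -two0; ring.
Qed.

(** The plane of (0, 0, 1): this point is the nucleus of the conic and, for the pointed conic, the
    deleted point. *)
Definition in_nucleus v := (v j0 == 0) && (v j1 == 0).

(** In even characteristic the nucleus is the only point off the conic that lies on no secant;
    points of the conic are covered with a zero coefficient. *)
Lemma conic_secant v : ~~ in_nucleus v ->
  exists p q x y, [/\ p \in conic cF, q \in conic cF & v = smul x p + smul y q].
Proof.
rewrite /in_nucleus negb_and -[v]vec3K !vec3E.
move: (v j0) (v j1) (v j2) => a b c.
have e2 : vec3 0 1 0 \in conic cF by apply/mem_conic; left.
have et t : vec3 1 (t ^+ 2) t \in conic cF by apply/mem_conic; right; exists t.
have [->|a0 _] := eqVneq a 0; last first.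
  (* The line joining v to (0, 1, 0) meets the conic again in the point with parameter c / a. *)
  exists (vec3 1 ((c / a) ^+ 2) (c / a)), (vec3 0 1 0), a, (b - c ^+ 2 / a).
  split=> //; rewrite !smul_vec3 vec3D; congr vec3; try by ring.
    by field.
  by field.
move=> /= b0; have [->|c0] := eqVneq c 0.
  exists (vec3 0 1 0), (vec3 0 1 0), b, 0.
  by split=> //; rewrite smul0 addr0 smul_vec3 !mulr0 mulr1.
(* The line joining (1, 0, 0) to (1, s^2, s) meets x0 = 0 in (0, s, 1), so s = b / c. *)
exists (vec3 1 ((b / c) ^+ 2) (b / c)), (vec3 1 (0 ^+ 2) 0), (c ^+ 2 / b), (c ^+ 2 / b).
split=> //; rewrite !smul_vec3 vec3D; congr vec3.
- by rewrite mulr1 addLL.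
- by field; rewrite b0.
- by field; rewrite b0.
Qed.

(** The point (0, 0, 1) completes the pointed conic to a hyperoval, hence lies on no secant. *)
Lemma pointed_conic_nucleus p q x y :
  p \in pointed_conic cF -> q \in pointed_conic cF ->
  in_nucleus (smul x p + smul y q) -> smul x p + smul y q = 0.
Proof.
rewrite /in_nucleus => /mem_pointed_conic[->|[t ->]] /mem_pointed_conic[->|[s ->]];
rewrite !smul_vec3 !vec3D !vec3E -vec3_0 ?mulr1 ?mulr0 ?addr0 ?add0r
  => /andP[/eqP e0 /eqP e1]; rewrite ?e1 ?e0 ?mul0r //.
have y0 : y = x by apply/eqP; rewrite -addL_eq0 addrC e0.
move: e1; rewrite y0 -!mulrDr => /eqP; rewrite mulf_eq0 addL_eq0.
case/orP=> /eqP ->; first by rewrite !mul0r.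
by rewrite !addLL mulr0.
Qed.

Definition on_planes (s : seq {vspace V}) v := has (fun U => v \in U) s.

Lemma on_elementaryP (pts : seq V) v :
  reflect (exists2 p, p \in pts & exists x, v = smul x p)
    (on_planes (elementary pts) v).
Proof.
apply: (iffP hasP) => [[_ /mapP[p hp ->] /mem_planeP h]|[p hp h]].
  by exists p.
by exists (plane_of_point p); [apply: map_f | apply/mem_planeP].
Qed.

Lemma conic_quadric v : on_planes (elementary (conic cF)) v ->
  v j2 ^+ 2 = v j0 * v j1.
Proof.
case/on_elementaryP=> p /mem_conic[->|[t ->]] [x ->]; rewrite smul_vec3 !vec3E; ring.
Qed.

Lemma conic_not_pointed :
  ~ proj_equiv (elementary (conic cF)) (elementary (pointed_conic cF)).
Proof.
case=> f [f0 /perm_mem fP].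
have finj : injective f by apply/lker0P.
have pull v : on_planes (elementary (pointed_conic cF)) v ->
    exists2 u, on_planes (elementary (conic cF)) u & f u = v.
  case/hasP=> U; rewrite -fP => /mapP[W hW ->] /memv_imgP[u hu ->].
  by exists u => //; apply/hasP; exists W.
have push u : on_planes (elementary (conic cF)) u ->
    on_planes (elementary (pointed_conic cF)) (f u).
  case/hasP=> W hW hu; apply/hasP; exists (f @: W)%VS; last exact: memv_img.
  by rewrite -fP; apply: map_f.
(* Otherwise [u] lies in a sum of two conic planes, so [f u] lies in a sum of two planes of the
   pointed conic; such a sum meets the nucleus plane only in zero. *)
have nuc u : in_nucleus (f u) -> in_nucleus u.
  move=> fu; apply/negPn/negP => nu.
  have [p [q [x [y [hp hq E]]]]] := conic_secant nu.
  have [p' hp' [x' Ep]] : exists2 p', p' \in pointed_conic cF &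
      exists x', f (smul x p) = smul x' p'.
    by apply/on_elementaryP/push/on_elementaryP; exists p => //; exists x.
  have [q' hq' [y' Eq]] : exists2 q', q' \in pointed_conic cF &
      exists y', f (smul y q) = smul y' q'.
    by apply/on_elementaryP/push/on_elementaryP; exists q => //; exists y.
  have fuE : f u = smul x' p' + smul y' q' by rewrite E linearD /= Ep Eq.
  have := @pointed_conic_nucleus p' q' x' y' hp' hq'; rewrite -fuE => /(_ fu).
  rewrite -(linear0 f) => /finj u0.
  by move: nu; rewrite u0 /in_nucleus !ffunE eqxx.
have [w w3] := exists_gen.
have w0 : w != 0.
  by apply/eqP=> w0; move: w3; rewrite w0 expr0n add0r => /eqP; rewrite eq_sym oner_eq0.
have w1 : 1 + w != 0.
  rewrite addrC addL_eq0; apply/eqP=> w1; move: w3; rewrite w1 expr1n addLL.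
  by move/eqP; rewrite oner_eq0.
have onP t x : on_planes (elementary (pointed_conic cF)) (vec3 x (x * t) (x * t ^+ 2)).
  apply/on_elementaryP; exists (vec3 1 t (t ^+ 2)).
    by apply/mem_pointed_conic; right; exists t.
  by exists x; rewrite smul_vec3 mulr1.
have onE2 : on_planes (elementary (pointed_conic cF)) (vec3 (0 : L) 1 0).
  apply/on_elementaryP; exists (vec3 (0 : L) 1 0); last by exists 1; rewrite smul1.
  by apply/mem_pointed_conic; left.
(* Modulo the nucleus plane the seven images are the nonempty partial sums of (0, 1), (1, 0) and (w,
   0). Their preimages compute a third difference on the conic side. *)
have [va qa Ea] := pull _ onE2.
have [vb qb Eb] := pull _ (onP 0 1).
have [vc qc Ec] := pull _ (onP 0 w).
have [vab qab Eab] := pull _ (onP 1 1).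
have [vac qac Eac] := pull _ (onP w^-1 w).
have [vbc qbc Ebc] := pull _ (onP 0 (1 + w)).
have [vabc qabc Eabc] := pull _ (onP (1 + w)^-1 (1 + w)).
have /andP[/eqP ab0 /eqP ab1] : in_nucleus (va + vb + vab).
  by apply: nuc; rewrite !linearD /= Ea Eb Eab !vec3D /in_nucleus !vec3E;
    apply/andP; split; apply/eqP; rewrite ?mulr0 ?mulr1 ?add0r ?addr0 ?addLL.
have /andP[/eqP ac0 /eqP ac1] : in_nucleus (va + vc + vac).
  by apply: nuc; rewrite !linearD /= Ea Ec Eac !vec3D /in_nucleus !vec3E;
    apply/andP; split; apply/eqP; rewrite ?mulfV // ?mulr0 ?add0r ?addr0 ?addLL.
have /andP[/eqP bc0 /eqP bc1] : in_nucleus (vb + vc + vbc).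
  by apply: nuc; rewrite !linearD /= Eb Ec Ebc !vec3D /in_nucleus !vec3E;
    apply/andP; split; apply/eqP; rewrite ?mulr0 ?addr0 ?addLL.
have /andP[/eqP abc0 /eqP abc1] : in_nucleus (va + vbc + vabc).
  by apply: nuc; rewrite !linearD /= Ea Ebc Eabc !vec3D /in_nucleus !vec3E;
    apply/andP; split; apply/eqP; rewrite ?mulfV ?mulr0 ?add0r ?addr0 ?addLL.
pose S := va + vb + vc + vab + vac + vbc + vabc.
(* The first two coordinates are additive modulo the nucleus. The square of the third is the
   quadratic x0 x1, whose third differences vanish. *)
have S0 : S = 0.
  have e (u v z : V) j : (u + v + z) j = 0 -> z j = u j + v j.
    by rewrite !ffunE => /eqP; rewrite addL_eq0 => /eqP.
  move/e: ab0; move/e: ab1; move/e: ac0; move/e: ac1.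
  move/e: bc0; move/e: bc1; move/e: abc0; move/e: abc1.
  move=> abc1 abc0 bc1 bc0 ac1 ac0 ab1 ab0.
  apply: eqVP; rewrite !ffunE.
  - rewrite abc0 bc0 ac0 ab0 -[RHS](mul0r (2%:R * (va j0 + vb j0 + vc j0))) -two0; ring.
  - rewrite abc1 bc1 ac1 ab1 -[RHS](mul0r (2%:R * (va j1 + vb j1 + vc j1))) -two0; ring.
  apply: sqrL_inj; rewrite expr0n !sqrD.
  rewrite !conic_quadric // abc0 bc0 ac0 ab0 abc1 bc1 ac1 ab1.
  rewrite -[RHS](mul0r ((va j0 + vb j0 + vc j0) * (va j1 + vb j1 + vc j1) +
    va j0 * va j1 + vb j0 * vb j1 + vc j0 * vc j1)) -two0; ring.
have : f S = 0 by rewrite S0 linear0.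
rewrite !linearD /= Ea Eb Ec Eab Eac Ebc Eabc !vec3D -vec3_0 => /vec3_inj[_ _] E.
(* The third coordinates of the images sum to 1 + 1/w + 1/(1 + w), so w would be a root of X^2 + X +
   1, which has none in GF(8). *)
have w21 : w ^+ 2 + w + 1 = 0.
  have := congr1 (fun z => w * (1 + w) * z - 2%:R * w) E.
  rewrite mulr0 [in RHS]two0 mul0r subr0 => <-.
  by field; rewrite w0 w1.
move: w0; have -> : w = (w - 1) * (w ^+ 2 + w + 1) - (w ^+ 3 - (w + 1)) by ring.
by rewrite w21 w3 subrr mulr0 subr0 eqxx.
Qed.
End Planes.

(** * Planes as graphs of coded maps *)

Section Coding.
Variables (F : finFieldType) (cF : 2 \in [pchar F]) (hF : #|F| = 8%N).
Local Notation L := (F8 cF).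
Local Notation V := (V9 cF).
Variables (w : L) (hw : w ^+ 3 = w + 1).
Implicit Types (x y k c : gf8) (a b g : map8) (p q : vec8) (U W : {vspace V}).

Definition phi x : L :=
  let: (x0, x1, x2) := x in (x0 : nat)%:R + (x1 : nat)%:R * w + (x2 : nat)%:R * w ^+ 2.

Lemma natr_addb (b1 b2 : bool) :
  ((b1 (+) b2 : bool) : nat)%:R = (b1 : nat)%:R + (b2 : nat)%:R :> L.
Proof. by case: b1 b2 => -[] //=; rewrite ?addr0 ?add0r ?addLL. Qed.

Lemma phi0 : phi zero8 = 0. Proof. by rewrite /phi /= !mul0r !addr0. Qed.

Lemma phi1 : phi one8 = 1. Proof. by rewrite /phi /= !mul0r !addr0. Qed.

Lemma phiD x y : phi (add8 x y) = phi x + phi y.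
Proof.
move: x y => [[x0 x1] x2] [[y0 y1] y2]; rewrite /phi /= !natr_addb; ring.
Qed.

Lemma phi_mulgen x : phi (mulgen8 x) = w * phi x.
Proof.
move: x => [[x0 x1] x2]; rewrite /phi /= natr_addb.
have -> : w * (x0%:R + x1%:R * w + x2%:R * w ^+ 2) =
  x0%:R * w + x1%:R * w ^+ 2 + x2%:R * w ^+ 3 by ring.
by rewrite hw; ring.
Qed.

Lemma phi_if (b : bool) x : phi (if b then x else zero8) = (b : nat)%:R * phi x.
Proof. by case: b; rewrite ?mul1r ?mul0r ?phi0. Qed.

Lemma phi_app a x : phi (app8 a x) =
  (x.1.1 : nat)%:R * phi a.1.1 + (x.1.2 : nat)%:R * phi a.1.2 + (x.2 : nat)%:R * phi a.2.
Proof.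
by move: a x => [[a0 a1] a2] [[x0 x1] x2]; rewrite /app8 !phiD !phi_if addrA.
Qed.

Lemma phi_mul x y : phi (mul8 x y) = phi x * phi y.
Proof.
rewrite /mul8 phi_app /mulmap8 /= !phi_mulgen; move: y => [[y0 y1] y2] /=.
by rewrite /phi; ring.
Qed.

(** A nonzero [x] has an inverse in the concrete field, and [phi] is multiplicative. *)
Lemma phi_eq0 x : phi x = 0 -> x = zero8.
Proof.
move=> x0; apply/eqP; apply/negPn/negP=> nx.
have : mul8 x (inv8 x) = one8 by move: x nx {x0} => [[[] []] []].
by move/(congr1 phi)/eqP; rewrite phi_mul x0 mul0r phi1 eq_sym oner_eq0.
Qed.

Lemma add8_eq0 x y : (add8 x y == zero8) = (x == y).
Proof. by move: x y => [[[] []] []] [[[] []] []]. Qed.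

Lemma phi_inj : injective phi.
Proof.
move=> x y E; apply/eqP; rewrite -add8_eq0; apply/eqP/phi_eq0.
by rewrite phiD E addLL.
Qed.

Definition psi (t : L) : gf8 := odflt zero8 [pick x | phi x == t].

Lemma psiK : cancel psi phi.
Proof.
move=> t; rewrite /psi; case: pickP => [x /eqP //|nx].
have : t \in codom phi.
  by apply: (inj_card_onto phi_inj); rewrite [#|L|]hF !card_prod card_bool.
by case/codomP=> x tE; have := nx x; rewrite tE eqxx.
Qed.

Lemma phiK : cancel phi psi.
Proof. by move=> x; apply: phi_inj; rewrite psiK. Qed.

Lemma phi_inv x : x != zero8 -> phi (inv8 x) = (phi x)^-1.
Proof.
move=> nx; have : mul8 x (inv8 x) = one8 by move: x nx => [[[] []] []].
move/(congr1 phi); rewrite phi_mul phi1 => E.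
have nz : phi x != 0 by apply: contraNneq nx => /phi_eq0 ->.
by apply: (mulfI nz); rewrite E mulfV.
Qed.

Lemma app8D a x y : app8 a (add8 x y) = add8 (app8 a x) (app8 a y).
Proof.
apply: phi_inj; rewrite phiD !phi_app.
move: x y => [[x0 x1] x2] [[y0 y1] y2] /=; rewrite !natr_addb; ring.
Qed.

Lemma app8_0 a : app8 a zero8 = zero8.
Proof. by move: a => [[a0 a1] a2]. Qed.

Lemma app8_inj a b : app8 a =1 app8 b -> a = b.
Proof.
have add0 : right_id zero8 add8 by move=> [[[] []] []].
have add0' : left_id zero8 add8 by move=> [[[] []] []].
have e0 (c : map8) : app8 c one8 = c.1.1.
  by move: c => [[c0 c1] c2]; rewrite -[LHS]/(add8 c0 zero8) add0.
have e1 (c : map8) : app8 c gen8 = c.1.2.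
  by move: c => [[c0 c1] c2]; rewrite -[LHS]/(add8 zero8 (add8 c1 zero8)) add0' add0.
have e2 (c : map8) : app8 c (mulgen8 gen8) = c.2.
  by move: c => [[c0 c1] c2]; rewrite -[LHS]/(add8 zero8 (add8 zero8 c2)) !add0'.
move=> E; move: (E one8) (E gen8) (E (mulgen8 gen8)); rewrite !e0 !e1 !e2.
by move: a b {E} => [[? ?] ?] [[? ?] ?] /= -> -> ->.
Qed.

Definition ph p : V := let: (p0, p1, p2) := p in vec3 (phi p0) (phi p1) (phi p2).

Lemma ph_add p q : ph (addv8 p q) = ph p + ph q.
Proof.
by move: p q => [[? ?] ?] [[? ?] ?]; rewrite /ph /= vec3D !phiD.
Qed.

Lemma ph_scale k p : ph (scale8 k p) = smul (phi k) (ph p).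
Proof. by move: p => [[? ?] ?]; rewrite /ph /= smul_vec3 !phi_mul. Qed.

Lemma ph_lin (h0 h1 h2 : vec8) p : ph (lin8 (h0, h1, h2) p) =
  smul (ph p j0) (ph h0) + smul (ph p j1) (ph h1) + smul (ph p j2) (ph h2).
Proof.
move: p => [[p0 p1] p2]; rewrite /lin8 !ph_add !ph_scale addrA.
by rewrite {3 6 9}/ph !vec3E.
Qed.

Definition pt a b x : V := vec3 (phi x) (phi (app8 a x)) (phi (app8 b x)).

(** Only an inclusion; for the planes concerned, [graph_uniq] supplies the converse. *)
Definition graph_in a b U := forall x, pt a b x \in U.

Definition E1 : {vspace V} := plane_of_point (vec3 1 0 0).
Definition E2 : {vspace V} := plane_of_point (vec3 0 1 0).
Definition E3 : {vspace V} := plane_of_point (vec3 0 0 1).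
Definition ED : {vspace V} := plane_of_point (vec3 1 1 1).

Lemma mem_E2 (t : L) : vec3 0 t 0 \in E2.
Proof. by apply/mem_planeP; exists t; rewrite smul_vec3 mulr0 mulr1. Qed.

Lemma mem_E3 (t : L) : vec3 0 0 t \in E3.
Proof. by apply/mem_planeP; exists t; rewrite smul_vec3 mulr0 mulr1. Qed.

Lemma E1_graph : graph_in (mulmap8 zero8) (mulmap8 zero8) E1.
Proof.
move=> x; apply/mem_planeP; exists (phi x); rewrite smul_vec3 mulr1 mulr0 /pt.
by rewrite -!/(mul8 _ _) phi_mul phi0 mul0r.
Qed.

Lemma ED_graph : graph_in (mulmap8 one8) (mulmap8 one8) ED.
Proof.
move=> x; apply/mem_planeP; exists (phi x); rewrite smul_vec3 mulr1 /pt.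
by rewrite -!/(mul8 _ _) phi_mul phi1 mul1r.
Qed.

Lemma plane_neq (u v : V) : (forall t : L, u <> smul t v) ->
  plane_of_point u != plane_of_point v.
Proof.
move=> h; apply/eqP=> E; have : u \in plane_of_point v.
  by rewrite -E; apply/mem_planeP; exists 1; rewrite smul1.
by case/mem_planeP=> t /h.
Qed.

Lemma frame_neq :
  [/\ E1 != E2, E1 != E3, ED != E2, ED != E3 & E2 != E3].
Proof.
split; apply: plane_neq => t; rewrite smul_vec3 => /vec3_inj[];
  rewrite ?mulr0 ?mulr1 => a b c; case/eqP: (oner_neq0 L);
  by [exact: a | exact: b].
Qed.

End Coding.

(** * Framed pseudo-ovals *)

Lemma exists_proj3 (K : fieldType) (vT : vectType K) (U1 U2 U3 : {vspace vT}) :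
  (U1 + U2 + U3)%VS = fullv ->
  exists p1 p2 p3 : 'End(vT), forall v,
    [/\ p1 v \in U1, p2 v \in U2, p3 v \in U3 & p1 v + p2 v + p3 v = v].
Proof.
move=> full.
exists (addv_pi1 U1 U2 \o addv_pi1 (U1 + U2) U3)%VF,
  (addv_pi2 U1 U2 \o addv_pi1 (U1 + U2) U3)%VF, (addv_pi2 (U1 + U2) U3) => v.
have v_full : v \in (U1 + U2 + U3)%VS by rewrite full memvf.
have v12 := memv_pi1 (U1 + U2) U3 v.
rewrite !comp_lfunE; split.
- exact: (memv_pi1 U1 U2 _).
- exact: (memv_pi2 U1 U2 _).
- exact: (memv_pi2 (U1 + U2) U3 _).
- by rewrite (addv_pi1_pi2 v12) (addv_pi1_pi2 v_full).
Qed.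

Section Frame.
Variables (F : finFieldType) (cF : 2 \in [pchar F]) (hF : #|F| = 8%N).
Local Notation L := (F8 cF).
Local Notation V := (V9 cF).
Implicit Types (u v : V) (U W : {vspace V}) (s : seq {vspace V}).

Lemma proj_equiv_img s (f : 'End(V)) :
  lker f == 0%VS -> proj_equiv s [seq (f @: U)%VS | U <- s].
Proof. by exists f. Qed.

Lemma proj_equiv_sym s1 s2 : proj_equiv s1 s2 -> proj_equiv s2 s1.
Proof.
case=> f [f0 fP]; exists (f^-1)%VF; split.
  apply/lker0P=> u v E; rewrite -(lker0_lfunVK f0 u) -(lker0_lfunVK f0 v) E //.
rewrite perm_sym in fP; apply: perm_trans (perm_map _ fP) _; rewrite -map_comp.
rewrite (@eq_map _ _ _ id) ?map_id // => U /=.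
by rewrite -limg_comp lker0_compVf // lim1g.
Qed.

Lemma proj_equiv_trans s1 s2 s3 :
  proj_equiv s1 s2 -> proj_equiv s2 s3 -> proj_equiv s1 s3.
Proof.
case=> f [f0 fP] [g [g0 gP]]; exists (g \o f)%VF; split.
  by apply/lker0P=> u v; rewrite !comp_lfunE => /(lker0P g0)/(lker0P f0).
apply: perm_trans gP; rewrite (eq_map (limg_comp f g)) map_comp.
exact: perm_map.
Qed.

Lemma dim_img0 (f : 'End(V)) U : lker f == 0%VS -> \dim (f @: U) = \dim U.
Proof. by move=> /eqP f0; rewrite limg_dim_eq // f0 capv0. Qed.

Lemma img0_inj (f : 'End(V)) : lker f == 0%VS -> injective (fun U => (f @: U)%VS).
Proof.
move=> f0 U W E; rewrite -[U]lim1g -[W]lim1g -(lker0_compVf f0) !limg_comp.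
by rewrite E.
Qed.

Lemma pseudo_oval_img s (f : 'End(V)) : lker f == 0%VS ->
  pseudo_oval s -> pseudo_oval [seq (f @: U)%VS | U <- s].
Proof.
move=> f0 [sz un dm full]; split.
- by rewrite size_map.
- by rewrite map_inj_uniq //; apply: img0_inj.
- by move=> _ /mapP[U hU ->]; rewrite dim_img0 // dm.
move=> _ _ _ /mapP[U1 h1 ->] /mapP[U2 h2 ->] /mapP[U3 h3 ->] n12 n13 n23.
rewrite -!limgD full //; first exact: lker0_limgf.
- by apply: contraNneq n12 => ->.
- by apply: contraNneq n13 => ->.
- by apply: contraNneq n23 => ->.
Qed.

Lemma exists_param U : \dim U = 3%N ->
  exists2 h : 'Hom(L, V), injective h & forall t, h t \in U.
Proof.
move=> dU.
have [b bU] : exists b : 3.-tuple V, basis_of U b.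
  by move: (vbasis U) (vbasisP U); rewrite dU => b bU; exists b.
have [e eL] : exists e : 3.-tuple L, basis_of {: L} e.
  by move: (vbasis {: L}) (vbasisP {: L}); rewrite (dimL cF hF) => e eL; exists e.
have [h hE] : exists h : 'Hom(L, V), h =1 fun t => \sum_(i < 3) coord e i t *: b`_i.
  apply: additive_lfun => x y; rewrite -big_split; apply: eq_bigr => i _ /=.
  by rewrite linearD scalerDl.
exists h => [x y|x]; last first.
  rewrite hE; apply: memv_suml => i _; rewrite memvZ // (basis_mem bU) //.
  by rewrite mem_nth ?size_tuple.
rewrite !hE => E; rewrite (coord_basis eL (memvf x)) (coord_basis eL (memvf y)).
apply: eq_bigr => i _; congr (_ *: _).
by have := congr1 (coord b i) E; rewrite !coord_sum_free ?(basis_free bU).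
Qed.

Lemma pseudo_oval_indep s U1 U2 U3 : pseudo_oval s ->
  U1 \in s -> U2 \in s -> U3 \in s -> U1 != U2 -> U1 != U3 -> U2 != U3 ->
  indep3s U1 U2 U3.
Proof.
move=> [sz un dm full] h1 h2 h3 n12 n13 n23.
by apply/(full3P hF); rewrite ?dm //; apply: full.
Qed.

Lemma img_plane (g : 'End(V)) u U : lker g == 0%VS -> u != 0 -> \dim U = 3%N ->
  (forall t, g (smul t u) \in U) -> (g @: plane_of_point u)%VS = U.
Proof.
move=> g0 u0 dU h; apply/eqP; rewrite eqEdim dim_img0 // dU (dim_plane hF u0) leqnn andbT.
by apply/subvP=> _ /memv_imgP[_ /mem_planeP[t ->] ->].
Qed.

Lemma frame_points_neq0 :
  [/\ vec3 (1 : L) 0 0 != 0, vec3 (0 : L) 1 0 != 0, vec3 (0 : L) 0 1 != 0 &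
      vec3 (1 : L) 1 1 != 0].
Proof.
by split; apply/eqP; rewrite -vec3_0 => /vec3_inj[a b c]; case/eqP: (oner_neq0 L).
Qed.

(** The analogue of moving four points in general position to the standard frame: an identification
    of the fourth plane with GF(8) is projected to the other three. *)
Lemma exists_frame s : pseudo_oval s -> exists s', [/\ proj_equiv s s',
  pseudo_oval s' & {subset [:: E1 cF; E2 cF; E3 cF; ED cF] <= s'}].
Proof.
move=> ov; have [sz un dm full] := ov.
case: s sz un dm full ov => [|U1 [|U2 [|U3 [|UD r]]]] //.
set s := [:: _, _, _, _ & _] => sz un dm full ov.
have [h1 h2 h3 hD] : [/\ U1 \in s, U2 \in s, U3 \in s & UD \in s].
  by split; rewrite !inE eqxx ?orbT.
have [n12 n13 n1D] : [/\ U1 != U2, U1 != U3 & U1 != UD].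
  by case/andP: un; rewrite !inE !negb_or => /and4P[].
have [n23 n2D n3D] : [/\ U2 != U3, U2 != UD & U3 != UD].
  case/and4P: un => _; rewrite !inE !negb_or => /and3P[-> -> _] /andP[-> _] _.
  by [].
have [h hinj hU] := exists_param (dm _ hD).
have [p1 [p2 [p3 pP]]] := exists_proj3 (full _ _ _ h1 h2 h3 n12 n13 n23).
(* [g] sends (t, t, t) to [h t], hence [ED] to the fourth plane, and each coordinate plane to one of
   the first three. *)
have [g gE] : exists g : 'End(V), g =1 fun v =>
    p1 (h (v j0)) + p2 (h (v j1)) + p3 (h (v j2)).
  apply: additive_lfun => u v; rewrite !ffunE !linearD /=.
  by rewrite [RHS]addrACA; congr (_ + _); exact: addrACA.
have h_eq0 t : h t = 0 -> t = 0 by rewrite -(linear0 h) => /hinj.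
have g0 : lker g == 0%VS.
  apply/lker0P=> u v /eqP; rewrite -subr_eq0 -linearB /= => /eqP.
  move: (u - v) (subr_eq0 u v) => x xE gx; apply/eqP; rewrite -xE; apply/eqP.
  move: gx; rewrite gE; set a := h (x j0); set b := h (x j1); set c := h (x j2).
  have [a1 a2 a3 aE] := pP a; have [b1 b2 b3 bE] := pP b; have [c1 c2 c3 cE] := pP c.
  move=> E.
  have [pa pb pc] := pseudo_oval_indep ov h1 h2 h3 n12 n13 n23 a1 b2 c3 E.
  (* If one component of a vector [h t] vanishes, then [h t] lies in the fourth plane and in the sum
     of two others, so it is zero. *)
  apply: eqVP; rewrite [RHS]ffunE; apply: h_eq0.
  - have [] // := pseudo_oval_indep ov hD h2 h3 _ _ n23 (hU (x j0)) a2 a3 _;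
      rewrite 1?eq_sym // -/a -{1}aE pa add0r -addrA addVV //.
  - have [] // := pseudo_oval_indep ov hD h1 h3 _ _ n13 (hU (x j1)) b1 b3 _;
      rewrite 1?eq_sym // -/b -{1}bE pb addr0 -addrA addVV //.
  - have [] // := pseudo_oval_indep ov hD h1 h2 _ _ n12 (hU (x j2)) c1 c2 _;
      rewrite 1?eq_sym // -/c -{1}cE pc addr0 -addrA addVV //.
have gV0 : lker (g^-1)%VF == 0%VS.
  by apply/lker0P=> u v E; rewrite -(lker0_lfunVK g0 u) -(lker0_lfunVK g0 v) E.
exists [seq (g^-1 @: U)%VS | U <- s]; split.
- exact: proj_equiv_img.
- exact: pseudo_oval_img.
have back W U : (g @: W)%VS = U -> U \in s -> W \in [seq (g^-1 @: U)%VS | U <- s].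
  move=> <- hW; apply/mapP; exists (g @: W)%VS => //.
  by rewrite -limg_comp lker0_compVf // lim1g.
have [e1 e2 e3 eD] := frame_points_neq0.
move=> W; rewrite !inE => /or4P[] /eqP ->.
- apply: (back _ U1) => //; apply: img_plane; rewrite ?dm // => t.
  rewrite gE smul_vec3 !vec3E !mulr0 !linear0 !addr0 mulr1.
  by have [] := pP (h t).
- apply: (back _ U2) => //; apply: img_plane; rewrite ?dm // => t.
  rewrite gE smul_vec3 !vec3E !mulr0 !linear0 addr0 add0r mulr1.
  by have [] := pP (h t).
- apply: (back _ U3) => //; apply: img_plane; rewrite ?dm // => t.
  rewrite gE smul_vec3 !vec3E !mulr0 !linear0 !add0r mulr1.
  by have [] := pP (h t).
- apply: (back _ UD) => //; apply: img_plane; rewrite ?dm // => t.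
  rewrite gE smul_vec3 !vec3E mulr1.
  by have [_ _ _ ->] := pP (h t); apply: hU.
Qed.

End Frame.

(** * Planes of a framed pseudo-oval as graphs *)

Section Framed.
Variables (F : finFieldType) (cF : 2 \in [pchar F]) (hF : #|F| = 8%N).
Local Notation L := (F8 cF).
Local Notation V := (V9 cF).
Variables (w : L) (hw : w ^+ 3 = w + 1).
Local Notation phi := (phi w).
Local Notation psi := (psi w).
Local Notation pt := (pt w).
Local Notation graph_in := (graph_in w).
Local Notation E1 := (E1 cF).
Local Notation E2 := (E2 cF).
Local Notation E3 := (E3 cF).
Local Notation ED := (ED cF).
Implicit Types (x y k c : gf8) (a b g : map8) (U W : {vspace V}).

Definition framed (s : seq {vspace V}) :=
  pseudo_oval s /\ {subset [:: E1; E2; E3; ED] <= s}.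

Variables (s : seq {vspace V}) (fr : framed s).

Let ov : pseudo_oval s := fr.1.

(** These planes are complements of [E2 + E3], the space x0 = 0, and therefore graphs over the first
    coordinate. *)
Definition affine U := [&& U \in s, U != E2 & U != E3].

Lemma framed_mem : [/\ E1 \in s, E2 \in s, E3 \in s & ED \in s].
Proof. by split; apply: fr.2; rewrite !inE eqxx ?orbT. Qed.

Lemma affine_frame : affine E1 /\ affine ED.
Proof.
have [h1 h2 h3 hD] := framed_mem; have [n12 n13 nD2 nD3 _] := frame_neq cF.
by rewrite /affine h1 hD n12 n13 nD2 nD3.
Qed.

Lemma E2_neq_E3 : E2 != E3. Proof. by have [] := frame_neq cF. Qed.

Lemma affine_graph U : affine U -> exists a b, graph_in a b U.
Proof.
case/and3P=> hU n2 n3; have [h1 h2 h3 hD] := framed_mem.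
have at0 (t : L) : exists y z : L, vec3 t y z \in U.
  have [_ _ _ full] := ov.
  have : vec3 t 0 0 \in (U + E2 + E3)%VS by rewrite full ?memvf // E2_neq_E3.
  case/memv_addP=> _ /memv_addP[u hu [_ /mem_planeP[y ->] ->]] [_ /mem_planeP[z ->] E].
  exists (u j1), (u j2); suff -> : t = u j0 by rewrite vec3K.
  have := congr1 (fun v : V => v j0) E.
  by rewrite !ffunE /= !mulr0 !addr0.
have [y0 [z0 m0]] := at0 1; have [y1 [z1 m1]] := at0 w.
have [y2 [z2 m2]] := at0 (w ^+ 2).
(* By additivity the values over 1, w and w^2 determine both maps. *)
exists (psi y0, psi y1, psi y2), (psi z0, psi z1, psi z2) => x.
have -> : pt (psi y0, psi y1, psi y2) (psi z0, psi z1, psi z2) x =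
   (if x.1.1 then vec3 1 y0 z0 else 0) + (if x.1.2 then vec3 w y1 z1 else 0)
   + (if x.2 then vec3 (w ^+ 2) y2 z2 else 0).
  rewrite /pt !phi_app // !psiK //; move: x => [[x0 x1] x2] /=; rewrite -vec3_0.
  by case: x0 x1 x2 => -[] -[]; rewrite !vec3D /= ?mul1r ?mul0r.
by rewrite !memvD //; case: ifP => _; rewrite ?mem0v.
Qed.

(** [v] and the point of the graph over the same first coordinate differ by a vector of [E2 + E3],
    which meets [U] trivially. *)
Lemma graph_uniq U a b (v : V) : affine U -> graph_in a b U -> v \in U ->
  v = pt a b (psi (v j0)).
Proof.
move=> /and3P[hU n2 n3] gU vU; have [h1 h2 h3 hD] := framed_mem.
set x := psi _.
have [] := pseudo_oval_indep hF ov hU h2 h3 n2 n3 E2_neq_E3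
  (memvD vU (gU x)) (mem_E2 (v j1 + pt a b x j1)) (mem_E3 (v j2 + pt a b x j2)).
  have xE : pt a b x j0 = v j0 by rewrite /pt vec3E psiK.
  by rewrite -[v + _]vec3K ![(v + _) _]ffunE xE !vec3D ?addr0 ?add0r !addLL ?addr0 vec3_0.
by move=> /eqP; rewrite -{1}(oppV (pt a b x)) subr_eq0 => /eqP.
Qed.

Lemma graph_map_uniq U a b a' b' : affine U ->
  graph_in a b U -> graph_in a' b' U -> a = a' /\ b = b'.
Proof.
move=> aU gU gU'.
have E x : pt a b x = pt a' b' x.
  by rewrite (graph_uniq aU gU' (gU x)) /pt vec3E phiK.
by split; apply: app8_inj => x; have [_ e1 e2] := vec3_inj (E x);
  apply: (phi_inj hw).
Qed.

Lemma pt_eq0 a b x : pt a b x = 0 -> x = zero8.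
Proof. by rewrite -vec3_0 => /vec3_inj[/(phi_eq0 hw)]. Qed.

(** If a and a' agree at x, the two points over x add up to a vector of [E3], a dependency among
    three planes; [E2] plays this part for b and b'. *)
Lemma graph_apart U U' a b a' b' : affine U -> affine U' -> U != U' ->
  graph_in a b U -> graph_in a' b' U' -> apart a a' /\ apart b b'.
Proof.
move=> /and3P[hU n2 n3] /and3P[hU' n2' n3'] ne gU gU'.
have [h1 h2 h3 hD] := framed_mem.
split; apply/allP=> x; rewrite mem_gf8_units; apply: contraNneq => E.
- have [] := pseudo_oval_indep hF ov hU hU' h3 ne n3 n3' (gU x) (gU' x)
    (mem_E3 (phi (app8 b x) + phi (app8 b' x))); last by move/pt_eq0 ->.
  by rewrite /pt !vec3D E ?addr0 !addLL vec3_0.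
- have [] := pseudo_oval_indep hF ov hU hU' h2 ne n2 n2' (gU x) (gU' x)
    (mem_E2 (phi (app8 a x) + phi (app8 a' x))); last by move/pt_eq0 ->.
  by rewrite /pt !vec3D E ?addr0 !addLL vec3_0.
Qed.

Lemma graph_indep8 U U' U'' v b v' b' v'' b'' :
  affine U -> affine U' -> affine U'' -> U != U' -> U != U'' -> U' != U'' ->
  graph_in (mulmap8 v) b U -> graph_in (mulmap8 v') b' U' ->
  graph_in (mulmap8 v'') b'' U'' -> indep8 (v, b) (v', b') (v'', b'').
Proof.
move=> aU aU' aU'' n1 n2 n3 g g' g''.
have /and3P[hU _ _] := aU; have /and3P[hU' _ _] := aU'; have /and3P[hU'' _ _] := aU''.
have ne : add8 v' v'' != zero8.
  rewrite add8_eq0; apply: contraTneq isT => E.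
  have [/allP/(_ one8)] := graph_apart aU' aU'' n3 g' g''.
  by rewrite E eqxx => /(_ isT).
have phi_ne : phi v' + phi v'' != 0.
  by rewrite -phiD; apply: contraNneq ne => /(phi_eq0 hw) ->.
rewrite /indep8; set k := mul8 _ _.
apply/allP=> x; rewrite mem_gf8_units /=; apply: contraNneq => E.
set y := mul8 k x in E.
have [] := pseudo_oval_indep hF ov hU hU' hU'' n1 n2 n3 (g x) (g' y) (g'' (add8 x y));
  last by move/pt_eq0 ->.
rewrite /pt !vec3D; have := congr1 phi E; rewrite !phiD phi0 addrA => ->.
rewrite -vec3_0; congr vec3; first by rewrite addLL.
have kE : phi k = (phi v + phi v'') / (phi v' + phi v'').
  by rewrite /k phi_mul // phi_inv // !phiD.
have mulE u z : phi (app8 (mulmap8 u) z) = phi u * phi z by rewrite -phi_mul.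
have yE : phi y = phi k * phi x by rewrite -phi_mul.
clearbody y; clearbody k; rewrite !mulE phiD yE kE.
have -> : phi v * phi x + phi v' * ((phi v + phi v'') / (phi v' + phi v'') * phi x) +
   phi v'' * (phi x + (phi v + phi v'') / (phi v' + phi v'') * phi x) =
   2%:R * ((phi v + phi v'') * phi x) by field.
by rewrite (two0 cF) mul0r.
Qed.

End Framed.

(** * Reduction to multiplications and the final classification *)

Section Classification.
Variables (F : finFieldType) (cF : 2 \in [pchar F]) (hF : #|F| = 8%N).
Local Notation L := (F8 cF).
Local Notation V := (V9 cF).
Variables (w : L) (hw : w ^+ 3 = w + 1).
Local Notation phi := (phi w).
Local Notation psi := (psi w).
Local Notation pt := (pt w).
Local Notation ph := (ph w).
Local Notation graph_in := (graph_in w).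
Local Notation E1 := (E1 cF).
Local Notation E2 := (E2 cF).
Local Notation E3 := (E3 cF).
Local Notation ED := (ED cF).
Implicit Types (x y k c : gf8) (a b g : map8) (U W : {vspace V}).

Lemma apart_zero g x : apart g (mulmap8 zero8) -> app8 g x = zero8 -> x = zero8.
Proof.
move=> /allP h E; apply/eqP/negPn; rewrite -mem_gf8_units; apply/negP=> /h.
by rewrite E; move: x {h E} => [[[] []] []].
Qed.

(** Applying one invertible map g to all three coordinates preserves the frame and turns the slope
    map a of a fifth plane into g a g^-1. *)
Lemma exists_mul_frame s : framed s -> exists s' c T b,
  [/\ proj_equiv s s', framed s', c \in [:: gen8; inv8 gen8], affine s' T &
      graph_in (mulmap8 c) b T].
Proof.
move=> fr; have [ov sub] := fr; have [sz un dm full] := ov.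
have [aE1 aED] := affine_frame fr.
have [T hT] : exists2 T, T \in s & T \notin [:: E1; E2; E3; ED].
  by apply: exists_notin; rewrite ?sz.
rewrite !inE !negb_or => /and4P[n1 n2 n3 nD].
have aT : affine s T by rewrite /affine hT n2 n3.
have [a [b gT]] := affine_graph hF hw fr aT.
have [ap0 _] := graph_apart hF hw fr aT aE1 n1 gT (E1_graph hw).
have [ap1 _] := graph_apart hF hw fr aT aED nD gT (ED_graph hw).
have : a \in fpf_enum by rewrite mem_fpf_enum ap0 ap1.
move/(allP fpf_conj_mul8)=> /hasP[c hc /hasP[g _ /andP[g0 /allP gE]]].
pose ga (t : L) : L := phi (app8 g (psi t)).
have gaE x : ga (phi x) = phi (app8 g x) by rewrite /ga phiK.
have gaD : {morph ga : t u / t + u}.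
  move=> t u; rewrite -{1}(psiK hF hw t) -{1}(psiK hF hw u) -phiD gaE.
  by rewrite (app8D hw) phiD.
have ga0 : ga 0 = 0 by rewrite -(phi0 w) gaE app8_0.
have ga_eq0 t : ga t = 0 -> t = 0.
  move/(phi_eq0 hw)/(apart_zero g0) => E.
  by rewrite -(psiK hF hw t) E phi0.
have [G GE] : exists G : 'End(V), G =1 fun v => vec3 (ga (v j0)) (ga (v j1)) (ga (v j2)).
  by apply: additive_lfun => u v; rewrite vec3D !ffunE !gaD.
have G0 : lker G == 0%VS.
  apply/lker0P=> u v /eqP; rewrite -subr_eq0 -linearB /= => /eqP.
  move: (u - v) (subr_eq0 u v) => z zE; rewrite GE -vec3_0.
  case/vec3_inj=> /ga_eq0 z0 /ga_eq0 z1 /ga_eq0 z2.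
  by apply/eqP; rewrite -zE -[z]vec3K z0 z1 z2 vec3_0.
have fix_plane (u : V) : u != 0 -> (forall t, exists t', G (smul t u) = smul t' u) ->
    (G @: plane_of_point u)%VS = plane_of_point u.
  move=> u0 h; apply: img_plane; rewrite ?(dim_plane hF) // => t.
  by apply/mem_planeP; apply: h.
have [e1 e2 e3 eD] := frame_points_neq0 cF.
have [G1 G2 G3 GD] : [/\ (G @: E1 = E1)%VS, (G @: E2 = E2)%VS, (G @: E3 = E3)%VS &
    (G @: ED = ED)%VS].
  by split; apply: fix_plane => // t; exists (ga t);
    rewrite GE !smul_vec3 !vec3E ?mulr0 ?mulr1 ?ga0.
have fr' : framed [seq (G @: U)%VS | U <- s].
  have [h1 h2 h3 hD] := framed_mem fr.
  split; first exact: pseudo_oval_img.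
  move=> W; rewrite !inE => /or4P[] /eqP ->.
  - by rewrite -G1; apply: map_f.
  - by rewrite -G2; apply: map_f.
  - by rewrite -G3; apply: map_f.
  - by rewrite -GD; apply: map_f.
have aT' : affine [seq (G @: U)%VS | U <- s] (G @: T)%VS.
  rewrite /affine map_f //=; apply/andP; split.
    by rewrite -[X in _ != X]G2 (inj_eq (img0_inj G0)).
  by rewrite -[X in _ != X]G3 (inj_eq (img0_inj G0)).
have [a' [b' gT']] := affine_graph hF hw fr' aT'.
exists [seq (G @: U)%VS | U <- s], c, (G @: T)%VS, b'; split=> //.
  exact: proj_equiv_img.
(* It is enough that a' (g x) = g (a x), since g a = c g by the choice of g and g is onto. *)
suff -> : mulmap8 c = a' by [].
apply: app8_inj => y; have [x xE] : exists x, app8 g x = y.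
  have : injective (app8 g).
    move=> x1 x2 E; apply/eqP; rewrite -add8_eq0; apply/eqP/(apart_zero g0).
    by apply/eqP; rewrite (app8D hw) add8_eq0 E.
  by case/injF_bij=> g' _ gK; exists (g' y); rewrite gK.
have GT : G (pt a b x) \in (G @: T)%VS by rewrite memv_img.
have := graph_uniq hF hw fr' aT' gT' GT; rewrite GE /pt !vec3E !gaE phiK //.
case/vec3_inj=> _ /(phi_inj hw) E _; rewrite -xE -E.
by apply/esym/eqP; apply: gE; rewrite mem_gf8_enum.
Qed.

Section MulFrame.
Variables (s : seq {vspace V}) (fr : framed s) (c : gf8) (T : {vspace V}) (bT : map8).
Hypotheses (hc : c \in [:: gen8; inv8 gen8]) (aT : affine s T).
Hypothesis (gT : graph_in (mulmap8 c) bT T).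

Lemma affine_mul U : affine s U -> exists v b, graph_in (mulmap8 v) b U.
Proof.
move=> aU; have [[sz un dm full] sub] := fr; have [aE1 aED] := affine_frame fr.
have [->|n1] := eqVneq U E1; first by exists zero8, (mulmap8 zero8); exact: E1_graph.
have [->|nD] := eqVneq U ED; first by exists one8, (mulmap8 one8); exact: ED_graph.
have [->|nT] := eqVneq U T; first by exists c, bT.
(* Nine planes leave one besides these six; it provides the second further map that [spread_is_mul8]
   asks for. *)
have [U' hU'] : exists2 U', U' \in s & U' \notin [:: E1; E2; E3; ED; T; U].
  by apply: exists_notin; rewrite ?sz.
rewrite !inE !negb_or => /and5P[n1' n2' n3' nD' /andP[nT' nU']].
have aU' : affine s U' by rewrite /affine hU' n2' n3'.
have [a [b gU]] := affine_graph hF hw fr aU.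
have [a' [b' gU']] := affine_graph hF hw fr aU'.
have [ap0 _] := graph_apart hF hw fr aU aE1 n1 gU (E1_graph hw).
have [ap1 _] := graph_apart hF hw fr aU aED nD gU (ED_graph hw).
have [apc _] := graph_apart hF hw fr aU aT nT gU gT.
have [ap0' _] := graph_apart hF hw fr aU' aE1 n1' gU' (E1_graph hw).
have [ap1' _] := graph_apart hF hw fr aU' aED nD' gU' (ED_graph hw).
have [apc' _] := graph_apart hF hw fr aU' aT nT' gU' gT.
rewrite eq_sym in nU'; have [apU _] := graph_apart hF hw fr aU aU' nU' gU gU'.
exists (app8 a one8), b; suff /eqP <- : is_mul8 a by [].
have /allP/(_ a) := allP spread_is_mul8 c hc.
rewrite mem_filter apc mem_fpf_enum ap0 ap1 => /(_ isT)/implyP; apply.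
by apply/hasP; exists a' => //; rewrite mem_filter apc' mem_fpf_enum ap0' ap1'.
Qed.

Definition code U : gf8 * map8 :=
  odflt (zero8, mulmap8 zero8)
    [pick vb : gf8 * map8 | [forall x, pt (mulmap8 vb.1) vb.2 x \in U]].

Lemma code_graph U : affine s U -> graph_in (mulmap8 (code U).1) (code U).2 U.
Proof.
move=> /affine_mul[v [b gU]] x; rewrite /code; case: pickP => [vb /forallP //|].
by move/(_ (v, b))/negP; case; apply/forallP.
Qed.

Lemma code_uniq U v b : affine s U -> graph_in (mulmap8 v) b U -> code U = (v, b).
Proof.
move=> aU gU; have [] := graph_map_uniq hF hw fr aU (code_graph aU) gU.
by case: (code U) => v' b' [-> _ _] /= ->.
Qed.

Lemma code_apart U U' : affine s U -> affine s U' -> U != U' ->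
  (code U).1 != (code U').1 /\ apart (code U).2 (code U').2.
Proof.
move=> aU aU' ne.
have [h1 h2] := graph_apart hF hw fr aU aU' ne (code_graph aU) (code_graph aU').
split=> //; apply: contraTneq h1 => ->; apply/negP => /allP/(_ one8 isT).
by rewrite eqxx.
Qed.

Lemma search_code : exists2 acc, classified acc &
  forall U, affine s U -> code U \in acc.
Proof.
have [[sz un dm full] sub] := fr; have [h1 h2 h3 hD] := framed_mem fr.
have [aE1 aED] := affine_frame fr.
pose R := [seq U <- s | (U != E2) && (U != E3)].
have RP U : (U \in R) = affine s U by rewrite mem_filter /affine andbC.
have Run : uniq R by rewrite filter_uniq.
have szR : size R = 7%N.
  apply/eqP; rewrite eqn_leq -[(7 <= _)%N]/(8 < (size R).+2)%N.
  rewrite -[(_ <= 7)%N]/((size R).+2 <= 9)%N -sz; apply/andP; split.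
    apply: (uniq_leq_size (s1 := [:: E2, E3 & R])).
      by rewrite /= Run inE negb_or E2_neq_E3 !RP /affine !eqxx /= !andbF.
    by move=> U; rewrite !inE RP => /or3P[/eqP ->|/eqP ->|/and3P[]].
  apply: (uniq_leq_size (s2 := [:: E2, E3 & R]) un) => U hU.
  by rewrite !inE RP /affine hU; do 2! case: eqP.
pose val U := (code U).1.
have val_inj : {in R &, injective val}.
  move=> U U'; rewrite !RP => aU aU' E; apply/eqP/negPn/negP => ne.
  by have [/eqP] := code_apart aU aU' ne.
pose vs := [seq val U | U <- R].
have vs_un : uniq vs by rewrite map_inj_in_uniq.
(* Seven slopes among eight field elements leave exactly one out. *)
have [m _ hm] : exists2 m, m \in gf8_enum & m \notin vs.
  by apply: exists_notin; rewrite // size_map szR.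
have vsP v : (v \in vs) = (v != m).
  apply/idP/idP => [hv|ne]; first by apply: contraNneq hm => <-.
  have mun : uniq (m :: vs) by rewrite /= hm.
  have sz8 : (size gf8_enum <= size (m :: vs))%N by rewrite /= size_map szR.
  have [_ E] := uniq_min_size mun (fun x _ => mem_gf8_enum x) sz8.
  by have := E v; rewrite mem_gf8_enum inE (negbTE ne).
(* The plane of slope [v] has in [R] the position of [v] in [vs]; the default [E1] is met only at
   [v = m], which the search skips. *)
pose B v := (code (nth E1 R (index v vs))).2.
have BE U : affine s U -> code U = (val U, B (val U)).
  move=> aU; rewrite /B nth_index_map ?RP //; rewrite /val.
  by case: (code U).
have onto v : v != m -> exists2 U, affine s U & code U = (v, B v).
  by rewrite -vsP => /mapP[U]; rewrite RP => aU ->; exists U => //; apply: BE.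
have code1 : code E1 = (zero8, mulmap8 zero8) by apply: code_uniq (E1_graph hw).
have codeD : code ED = (one8, mulmap8 one8) by apply: code_uniq (ED_graph hw).
have m0 : zero8 != m by rewrite -vsP; apply/mapP; exists E1; rewrite ?RP // /val code1.
have m1 : one8 != m by rewrite -vsP; apply/mapP; exists ED; rewrite ?RP // /val codeD.
have B0 : B zero8 = mulmap8 zero8.
  by have := BE _ aE1; rewrite /val code1 => -[].
have B1 : B one8 = mulmap8 one8.
  by have := BE _ aED; rewrite /val codeD => -[].
pose vs0 := [seq v <- gf8_units | (v != one8) && (v != m)].
(* The planes [ED] and [E1] are fixed from the start and lie at the bottom of the stack. *)
pose us := [:: one8; zero8].
have memP v : (v \in catrev vs0 us) = (v != m).
  move: m0 m1; rewrite /vs0; clear; move: m v.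
  by move=> [[[] []] []] [[[] []] []].
have un0 : uniq (catrev vs0 us).
  by rewrite /vs0; clear; move: m => [[[] []] []].
exists [seq (u, B u) | u <- catrev vs0 us]; last first.
  move=> U aU; rewrite (BE U aU); apply/mapP; exists (val U) => //.
  by rewrite memP -vsP map_f ?RP.
apply: search_map => //.
- have mm : m \in [seq v <- gf8_units | v != one8].
    by rewrite mem_filter mem_gf8_units eq_sym m1 eq_sym m0.
  by have := allP search_classified m mm; rewrite /us /= B0 B1.
- move=> v hv; have [U aU cU] : exists2 U, affine s U & code U = (v, B v).
    by apply: onto; move: hv; rewrite mem_filter => /andP[/andP[]].
  have v0 : v != zero8 by move: hv; rewrite mem_filter mem_gf8_units => /andP[].
  have v1 : v != one8 by move: hv; rewrite mem_filter => /andP[/andP[]].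
  rewrite mem_fpf_enum -[B v]/(v, B v).2 -cU.
  rewrite -[X in apart _ X]/(zero8, mulmap8 zero8).2 -code1.
  rewrite -[mulmap8 one8]/(one8, mulmap8 one8).2 -codeD.
  have ne1 : U != E1 by apply: contraNneq v0 => UE; move: cU; rewrite UE code1 => -[->].
  have neD : U != ED by apply: contraNneq v1 => UE; move: cU; rewrite UE codeD => -[->].
  by have [_ ->] := code_apart aU aE1 ne1; have [_ ->] := code_apart aU aED neD.
- move=> v u; rewrite !memP => /onto[U aU cU] /onto[U' aU' cU'] ne.
  have neU : U != U' by apply: contraNneq ne => UE; move: cU; rewrite UE cU' => -[->].
  by have [_] := code_apart aU aU' neU; rewrite cU cU'.
- move=> v u t; rewrite !memP => /onto[U aU cU] /onto[U' aU' cU'].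
  case/onto=> U'' aU'' cU'' n1 n2 n3.
  apply: (graph_indep8 hF hw fr aU aU' aU'').
  + by apply: contraNneq n1 => UE; move: cU; rewrite UE cU' => -[->].
  + by apply: contraNneq n2 => UE; move: cU; rewrite UE cU'' => -[->].
  + by apply: contraNneq n3 => UE; move: cU'; rewrite UE cU'' => -[->].
  + by have := code_graph aU; rewrite cU.
  + by have := code_graph aU'; rewrite cU'.
  + by have := code_graph aU''; rewrite cU''.
Qed.

Lemma phE x y k : ph (x, y, k) = vec3 (phi x) (phi y) (phi k).
Proof. by []. Qed.

Lemma mul_graph_plane U v d : \dim U = 3%N ->
  graph_in (mulmap8 v) (mulmap8 d) U -> U = plane_of_point (ph (one8, v, d)).
Proof.
move=> dU gU; apply/eqP; rewrite eq_sym eqEdim dU (dim_plane hF); last first.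
  rewrite phE phi1 -vec3_0; apply/eqP => /vec3_inj[/eqP].
  by rewrite oner_eq0.
rewrite leqnn andbT; apply/subvP=> _ /mem_planeP[t ->].
have := gU (psi t); rewrite /pt -!/(mul8 _ _) !phi_mul // psiK //
  phE smul_vec3 phi1 mulr1.
by rewrite ![t * _]mulrC.
Qed.

Lemma affine_plane acc U : all (fun p => is_mul8 p.2) acc -> code U \in acc ->
  affine s U -> U = plane_of_point (ph (point8 (code U))).
Proof.
move=> /allP mulP /mulP /eqP E aU; have [[_ _ dm _] _] := fr.
apply: mul_graph_plane; first by case/and3P: aU => /dm.
by have := code_graph aU; rewrite {1}E.
Qed.

(** Each plane of [s] is the image of a target plane under the GF(8)-linear map with columns h0, h1,
    h2. As [s] spans, this map is onto, hence invertible; with nine planes on both sides the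
    covering is a bijection. *)
Lemma cover_equiv (target pts : seq vec8) (h : vec8 * vec8 * vec8) (tpts : seq V) :
  pseudo_oval (elementary tpts) -> {in target, forall q, ph q \in tpts} ->
  (forall p, p \in pts ->
     exists q k, [/\ q \in target, k != zero8 & scale8 k p = lin8 h q]) ->
  (forall U, U \in s -> exists2 p, p \in pts & U = plane_of_point (ph p)) ->
  proj_equiv s (elementary tpts).
Proof.
move: h => [[h0 h1] h2] [tsz tun tdm tfull] tP cov ptsP; apply: proj_equiv_sym.
have [[sz un dm full] sub] := fr.
have [H HE] : exists H : 'End(V), H =1 fun v =>
    smul (v j0) (ph h0) + smul (v j1) (ph h1) + smul (v j2) (ph h2).
  apply: additive_lfun => u v; rewrite !ffunE !smulDl.
  by rewrite [RHS]addrACA; congr (_ + _); exact: addrACA.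
have HZ t v : H (smul t v) = smul t (H v).
  by rewrite !HE !smulE !smulDr !smulA.
have tW U : U \in s -> exists2 W, W \in elementary tpts & U = (H @: W)%VS.
  move=> hU; have [p hp UE] := ptsP U hU; have [q [k [hq k0 E]]] := cov p hp.
  have hW : plane_of_point (ph q) \in elementary tpts by apply/map_f/tP.
  exists (plane_of_point (ph q)) => //; apply/eqP; rewrite eqEdim; apply/andP; split.
    apply/subvP=> v; rewrite UE => /mem_planeP[t ->].
    have -> : smul t (ph p) = H (smul (t / phi k) (ph q)).
      rewrite HZ HE -ph_lin // -E ph_scale // smulA divfK //.
      by apply: contraNneq k0 => /(phi_eq0 hw) ->.
    by apply/memv_img/mem_planeP; exists (t / phi k).
  apply: leq_trans (_ : \dim (plane_of_point (ph q)) <= _)%N.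
    by rewrite -(limg_ker_dim H (plane_of_point (ph q))) leq_addl.
  by rewrite (dm _ hU) (tdm _ hW).
have H0 : lker H == 0%VS.
  have [h1' h2' h3' _] := framed_mem fr; have [n12 n13 _ _ n23] := frame_neq cF.
  have := limg_ker_dim H fullv; have -> : limg H = fullv.
    have sub_img U : U \in s -> (U <= limg H)%VS.
      by move=> /tW[W _ ->]; rewrite limgS ?subvf.
    have : (E1 + E2 + E3 <= limg H)%VS by rewrite !subv_add !sub_img.
    by rewrite (full _ _ _ h1' h2' h3' n12 n13 n23) => h;
      apply/eqP; rewrite eqEsubv subvf.
  by rewrite capfv -dimv_eq0 => /(canRL (addnK _)) ->; rewrite subnn.
exists H; split=> //; rewrite perm_sym.
have sub_im : {subset s <= [seq (H @: U)%VS | U <- elementary tpts]}.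
  by move=> U /tW[W hW ->]; apply: map_f.
have sz_im : (size [seq (H @: U)%VS | U <- elementary tpts] <= size s)%N.
  by rewrite size_map tsz sz.
apply: uniq_perm => //; first exact: leq_size_uniq sub_im sz_im.
by case: (uniq_min_size un sub_im sz_im).
Qed.

Lemma mul_frame_classified : proj_equiv s (elementary (conic cF)) \/
  proj_equiv s (elementary (pointed_conic cF)).
Proof.
have [acc /classifiedP[mulP [h [target tE cov]]] codeP] := search_code.
have ptsP U : U \in s -> exists2 p,
    p \in [:: unit8 1, unit8 2 & [seq point8 p | p <- acc]] & U = plane_of_point (ph p).
  move=> hU; have [->|n2] := eqVneq U E2.
    by exists (unit8 1); rewrite ?inE ?eqxx // phE phi0 phi1.
  have [->|n3] := eqVneq U E3.
    by exists (unit8 2); rewrite ?inE ?eqxx ?orbT // phE phi0 phi1.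
  have aU : affine s U by rewrite /affine hU n2 n3.
  exists (point8 (code U)); last exact: affine_plane mulP (codeP U aU) aU.
  by rewrite !inE map_f ?orbT // codeP.
case: tE cov => -> cov; [left | right].
  apply: cover_equiv cov ptsP; first exact: conic_pseudo_oval.
  move=> q; rewrite inE => /orP[/eqP ->|/mapP[t _ ->]]; apply/mem_conic => //.
    by left; rewrite phE phi0 phi1.
  by right; exists (phi t); rewrite phE phi1 phi_mul.
apply: cover_equiv cov ptsP; first exact: pointed_conic_pseudo_oval.
move=> q; rewrite inE => /orP[/eqP ->|/mapP[t _ ->]]; apply/mem_pointed_conic => //.
  by left; rewrite phE phi0 phi1.
by right; exists (phi t); rewrite phE phi1 phi_mul.
Qed.

End MulFrame.
End Classification.

Theorem theorem5 (F : finFieldType) (cF : 2 \in [pchar F]) (hF : #|F| = 8%N) :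
  [/\ pseudo_oval (elementary (conic cF)),
      pseudo_oval (elementary (pointed_conic cF)),
      ~ proj_equiv (elementary (conic cF)) (elementary (pointed_conic cF)) &
      forall s : seq {vspace V9 cF}, pseudo_oval s ->
        proj_equiv s (elementary (conic cF)) \/
        proj_equiv s (elementary (pointed_conic cF))].
Proof.
split.
- exact: conic_pseudo_oval.
- exact: pointed_conic_pseudo_oval.
- exact: conic_not_pointed.
move=> s ov; have [w hw] := exists_gen cF hF.
have [s1 [eq1 ov1 sub1]] := exists_frame hF ov.
have [s2 [c [T [b [eq2 fr2 hc aT gT]]]]] := exists_mul_frame hF hw (conj ov1 sub1).
have [e|e] := mul_frame_classified hF hw fr2 hc aT gT; [left | right];
  exact: proj_equiv_trans (proj_equiv_trans eq1 eq2) e.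
Qed.
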